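(* Let $q$ be a power of a prime $p$ and let $F$ be an algebraic function field of one variable over the finite field $\mathbb{F}_q$. Then there exists an element $y\in F$, transcendental over $\mathbb{F}_q$, such that in the extension $F/\mathbb{F}_q(y)$ at most one place of the rational function field $\mathbb{F}_q(y)$ is ramified, and this place (if it exists) is $(y=\infty)$.
   Context: A function field over $\mathbb{F}_q$ means an algebraic function field of one variable with constant field $\mathbb{F}_q$. For a rational function field $\mathbb{F}(y)$ and $\alpha$ in the constant field, $(y=\alpha)$ denotes the zero of $y-\alpha$ and $(y=\infty)$ the pole of $y$. A place $Q$ of $\mathbb{F}_q(y)$ is ramified in $F/\mathbb{F}_q(y)$ if some place $P$ of $F$ lying over $Q$ has ramification index $e(P|Q)>1$. *)

(* Defs.v *)
From HB Require Import structures.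
From mathcomp Require Import all_boot all_order all_algebra.
From mathcomp Require Import boolp classical_sets.

Set Implicit Arguments.
Unset Strict Implicit.
Unset Printing Implicit Defensive.

Import Order.TTheory GRing.Theory Num.Theory.
Local Open Scope ring_scope.
Local Open Scope classical_set_scope.

(* A field extension F/k is given by a ring morphism iota : k -> F;
   intermediate fields of F/k are subsets of F. *)

Definition transcendental (k F : fieldType) (iota : {rmorphism k -> F})
    (y : F) : Prop :=
  ~ algebraicOver iota y.

Definition rational_subfield (k F : fieldType) (iota : {rmorphism k -> F})
    (y : F) : set F :=
  [set z | exists f g : {poly k}, (map_poly iota g).[y] != 0 /\
     z = (map_poly iota f).[y] / (map_poly iota g).[y]].

(* [F : E] is finite: F is spanned over the subfield E by finitely many b_i. *)
Definition finite_over (F : fieldType) (E : set F) : Prop :=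
  exists (n : nat) (b : 'I_n -> F), forall z : F,
    exists c : 'I_n -> F, (forall i, E (c i)) /\ z = \sum_(i < n) c i * b i.

(* The second clause says that k is the full constant field of F, i.e., that
   k is algebraically closed in F. *)
Definition function_field (k F : fieldType) (iota : {rmorphism k -> F}) :
    Prop :=
  (exists x : F, transcendental iota x /\
                 finite_over (rational_subfield iota x)) /\
  (forall z : F, algebraicOver iota z -> exists a : k, z = iota a).

(* O is a valuation ring of E/k: a ring with k < O < E (strict inclusions)
   that contains z or 1/z for every z in E. *)
Record valuation_ring (k F : fieldType) (iota : {rmorphism k -> F})
    (E O : set F) : Prop := ValuationRing {
  valuation_ring1 : O 1;
  valuation_ringB : forall x y, O x -> O y -> O (x - y);
  valuation_ringM : forall x y, O x -> O y -> O (x * y);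
  valuation_ring_const : range iota `<` O;
  valuation_ring_proper : O `<` E;
  valuation_ring_inv : forall z, E z -> O z \/ O z^-1 }.

(* A place P of E/k is the maximal ideal of a valuation ring O_P of E/k. As P
   and O_P determine each other, a place is recorded by O_P, and the ideal P is
   recovered as [place_ideal], the set of nonunits of O_P. *)
Record place (k F : fieldType) (iota : {rmorphism k -> F}) (E : set F) :=
  Place { place_ring : set F;
          place_ringP : valuation_ring iota E place_ring }.

Definition place_unit (k F : fieldType) (iota : {rmorphism k -> F})
    (E : set F) (P : place iota E) : set F :=
  [set u | place_ring P u /\ exists2 w, place_ring P w & u * w = 1].

Definition place_ideal (k F : fieldType) (iota : {rmorphism k -> F})
    (E : set F) (P : place iota E) : set F :=
  place_ring P `\` place_unit P.

Definition prime_element (k F : fieldType) (iota : {rmorphism k -> F})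
    (E : set F) (P : place iota E) (t : F) : Prop :=
  place_ideal P = [set t * w | w in place_ring P].

(* v_P(z) = n, for z in E nonzero: z = t^n u with t a prime element of P and u
   a unit of O_P. It never holds at z = 0, where v_P is infinite. *)
Definition has_valuation (k F : fieldType) (iota : {rmorphism k -> F})
    (E : set F) (P : place iota E) (z : F) (n : int) : Prop :=
  exists t u : F, [/\ prime_element P t, place_unit P u & z = t ^ n * u].

Definition is_pole (k F : fieldType) (iota : {rmorphism k -> F})
    (E : set F) (P : place iota E) (z : F) : Prop :=
  exists2 n : int, has_valuation P z n & n < 0.

Definition lies_over (k F : fieldType) (iota : {rmorphism k -> F})
    (E : set F) (P : place iota [set: F]) (Q : place iota E) : Prop :=
  place_ideal Q `<=` place_ideal P.

(* e(P|Q) = e: v_P(x) = e * v_Q(x) for all nonzero x in E. *)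
Definition has_ramification_index (k F : fieldType)
    (iota : {rmorphism k -> F}) (E : set F)
    (P : place iota [set: F]) (Q : place iota E) (e : nat) : Prop :=
  forall (x : F) (n : int), E x -> x != 0 ->
    has_valuation Q x n -> has_valuation P x (e%:Z * n).

Definition ramified (k F : fieldType) (iota : {rmorphism k -> F})
    (E : set F) (Q : place iota E) : Prop :=
  exists (P : place iota [set: F]) (e : nat),
    [/\ lies_over P Q, has_ramification_index P Q e & (1 < e)%N].

(* Main.v *)
Require Import Defs.
From HB Require Import structures.
From mathcomp Require Import all_boot all_order all_algebra all_field.
From mathcomp Require Import boolp classical_sets.
From mathcomp Require Import ring zify.

Set Implicit Arguments.
Unset Strict Implicit.
Unset Printing Implicit Defensive.

Import Order.TTheory GRing.Theory Num.Theory.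
Local Open Scope ring_scope.
Local Open Scope classical_set_scope.

(* Choose x such that F/k(x) is separable: among relations G(x, z) = 0 of
   minimal degree one partial derivative is nonzero, as otherwise G would be a
   p-th power. With q = #|k|, every nonzero polynomial over k divides a power of
   X^M - X for some power M = q^l of q, so M can be chosen such that the places
   of F that are bad for x are zeros or poles of S = x^M - x. Put
   y = S^p + 1/S: its poles are exactly the zeros and poles of S, hence a place
   P where y is regular is good for x.

   At a good P let h be the minimal polynomial over k of the residue of x, let
   H = h(x), and let A be the ring generated over k by x, inverses of P-units
   and simple roots of polynomials over A. Taylor expansion gives
   z^N - z in H A for all z in A and suitable powers N of q, so every z in A
   that vanishes at P is divisible by H. As Frac A = F, this makes H a prime
   element of P, and x^N - x is H times a unit since (X^N - X)' = -1. Finally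
   y^N - y is a unit times x^N - x, so it has a simple zero at P, whereas a
   place of k(y) ramified in P would give it a multiple zero. *)

(** * Algebraic elements over k(u) *)

Definition ratpred (k F : fieldType) (iota : {rmorphism k -> F}) (u : F) :
  {pred F} := fun z => `[< rational_subfield iota u z >].

(** Convertible to [(map_poly iota f).[x]], the form occurring in [rational_subfield], but packaged
    as a ring morphism. *)
Definition eval_at (k F : fieldType) (iota : {rmorphism k -> F}) (x : F) :
  {poly k} -> F := horner_morph (fun a => mulrC x (iota a)).

HB.instance Definition _ (k F : fieldType) (iota : {rmorphism k -> F})
  (x : F) := GRing.RMorphism.on (eval_at iota x).

Section RationalSubfield.
Variables (k F : fieldType) (iota : {rmorphism k -> F}).
Implicit Types (u v x z : F).

Local Notation ev := (eval_at iota).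

Lemma eval_atC x a : ev x a%:P = iota a.
Proof. by rewrite /eval_at /horner_morph map_polyC hornerC. Qed.

Lemma eval_atX x : ev x 'X = x.
Proof. by rewrite /eval_at /horner_morph map_polyX hornerX. Qed.

Lemma rational_subfieldP u z : rational_subfield iota u z <->
  exists f g : {poly k}, ev u g != 0 /\ z = ev u f / ev u g.
Proof. by []. Qed.

Lemma rational_subfield_eval u p : rational_subfield iota u (ev u p).
Proof. by exists p, 1; rewrite rmorph1 hornerC divr1 oner_neq0. Qed.

Lemma ratpred_divring u : divring_closed (ratpred iota u).
Proof.
split=> [|x y /asboolP/rational_subfieldP[f [g [g0 ->]]]
             /asboolP/rational_subfieldP[f' [g' [g'0 ->]]]
         |x y /asboolP/rational_subfieldP[f [g [g0 ->]]]
             /asboolP/rational_subfieldP[f' [g' [g'0 ->]]]];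
  apply/asboolP.
- by exists 1, 1; rewrite !rmorph1 hornerC divr1 oner_neq0.
- apply/rational_subfieldP; exists (f * g' - f' * g), (g * g').
  rewrite rmorphB !rmorphM /= mulf_neq0 //; split=> //; field;
  by rewrite g0 g'0.
- apply/rational_subfieldP.
  have [f'0|f'0] := eqVneq (ev u f') 0.
    by exists 0, 1; rewrite rmorph1 oner_neq0 rmorph0 f'0 !mul0r invr0 mulr0.
  exists (f * g'), (g * f'); rewrite !rmorphM /= mulf_neq0 //; split=> //; field.
  by rewrite g0 f'0.
Qed.

HB.instance Definition _ u :=
  GRing.isDivringClosed.Build F (ratpred iota u) (ratpred_divring u).

(** Turns the subset k(u) into a field type, so that [algebraicOver] and its closure properties
    apply. *)
Definition ratfield u := {z : F | z \in ratpred iota u}.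
HB.instance Definition _ u := SubType.on (ratfield u).
HB.instance Definition _ u := [Choice of ratfield u by <:].
HB.instance Definition _ u := [SubChoice_isSubIntegralDomain of ratfield u by <:].
HB.instance Definition _ u := [SubIntegralDomain_isSubField of ratfield u by <:].

Definition alg_over u := algebraicOver (val : ratfield u -> F).

Lemma alg_over_rat u z : rational_subfield iota u z -> alg_over u z.
Proof.
move=> zu; have zP : z \in ratpred iota u by apply/asboolP.
exact: (algebraic_id val (Sub z zP : ratfield u)).
Qed.

(** Over a field, algebraic means integral, and a root of a nonzero polynomial with integral
    coefficients is integral. *)
Lemma alg_over_root u (p : {poly F}) z : p != 0 -> p.[z] = 0 ->
  (forall i, alg_over u p`_i) -> alg_over u z.
Proof.
move=> p0 /rootP pz0 algp; apply/integral_algebraic.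
apply: integral_root p0 pz0 _ => _ /(nthP 0)[i _ <-].
by have /integral_algebraic := algp i.
Qed.

Lemma clear_denominators u (p : {poly F}) :
  (forall i, rational_subfield iota u p`_i) ->
  exists (G : {poly {poly k}}) (g : {poly k}),
    ev u g != 0 /\ map_poly (ev u) G = ev u g *: p.
Proof.
elim/poly_ind: p => [|p c IH] Hp.
  by exists 0, 1; rewrite rmorph1 oner_neq0 rmorph0 scaler0.
have [|G [g [g0 Gg]]] := IH.
  by move=> i; have := Hp i.+1; rewrite coefD coefMX coefC /= addr0.
have := Hp 0; rewrite coefD coefMX coefC /= add0r.
move=> /rational_subfieldP[f [h [h0 ->]]].
exists (h *: G * 'X + (g * f)%:P), (g * h); rewrite rmorphM mulf_neq0 //.
split=> //; rewrite rmorphD rmorphM /= map_polyZ Gg map_polyX map_polyC /=.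
rewrite rmorphM /= scalerDr scalerA -scalerAl (mulrC (ev u h)).
congr (_ + _).
by rewrite -mul_polyC -polyCM; congr (_%:P); field.
Qed.

Lemma alg_over_relation u v : alg_over u v ->
  exists2 G : {poly {poly k}}, G != 0 & (map_poly (ev u) G).[v] = 0.
Proof.
move=> [p p0 /rootP pv].
have [i|G [g [g0 Gg]]] := @clear_denominators u (map_poly val p).
  by rewrite coef_map; apply/asboolP; exact: (valP (p`_i)).
exists G; last by rewrite Gg hornerZ pv mulr0.
apply: contraNneq p0 => G0; rewrite -(map_poly_eq0 (val : ratfield u -> F)).
by move/eqP: Gg; rewrite G0 rmorph0 eq_sym scaler_eq0 (negPf g0).
Qed.

Lemma relation_alg_over u v (G : {poly {poly k}}) : map_poly (ev u) G != 0 ->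
  (map_poly (ev u) G).[v] = 0 -> alg_over u v.
Proof.
move=> G0 Gv; apply: alg_over_root G0 Gv _ => i; rewrite coef_map.
exact/alg_over_rat/rational_subfield_eval.
Qed.

Lemma transcendental_eval u p : transcendental iota u -> p != 0 -> ev u p != 0.
Proof. by move=> tu p0; apply/eqP => /rootP pu; apply: tu; exists p. Qed.

(** A relation G(v, u) = 0 is read with its two variables exchanged; transcendence of [u] keeps the
    exchanged polynomial nonzero once its coefficients are evaluated at [u]. *)
Lemma alg_over_swap u v : transcendental iota u -> alg_over v u -> alg_over u v.
Proof.
move=> tu /alg_over_relation[G G0 Gu].
have evE (p : {poly {poly k}}) x y :
  (map_poly (ev x) p).[y] = (map_poly (ev y) (swapXY p)).[x].
  elim/poly_ind: p => [|p c IH]; first by rewrite !rmorph0 !horner0.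
  rewrite !rmorphD !rmorphM /= !hornerE IH swapXY_X swapXY_polyC map_polyX.
  rewrite !map_polyC !hornerC /= hornerX; congr (_ * _ + _).
    by rewrite eval_atX.
  rewrite /= -map_poly_comp.
  by congr (_.[_]); apply: eq_map_poly => a /=; rewrite eval_atC.
apply: (@relation_alg_over _ _ (swapXY G)); last by rewrite -evE.
have /eqP : swapXY G != 0 by rewrite swapXY_eq0.
move=> sG0; apply/eqP => mG; apply: sG0; apply/polyP => i; rewrite coef0.
have /polyP/(_ i) := mG; rewrite coef_map coef0 => /eqP.
by apply: contraTeq => /(transcendental_eval tu).
Qed.

Lemma alg_over_trans u v w : alg_over u v -> alg_over v w -> alg_over u w.
Proof.
move=> uv [p p0 /rootP pw].
apply: (@alg_over_root _ (map_poly val p)); rewrite ?map_poly_eq0 //.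
move=> i; rewrite coef_map /=.
have /asboolP/rational_subfieldP[f [g [g0 ->]]] := valP p`_i.
have aev h : alg_over u (ev v h).
  elim/poly_ind: h => [|h c IH]; first by rewrite rmorph0; apply: algebraic0.
  rewrite rmorphD rmorphM /= eval_atX eval_atC; apply: algebraic_add.
    exact: algebraic_mul.
  by rewrite -(eval_atC u); apply/alg_over_rat/rational_subfield_eval.
by apply: algebraic_div; apply: aev.
Qed.

(** Multiplication by [z] acts on the spanning family [b] through a matrix over k(x), whose
    characteristic polynomial has the root [z]. *)
Lemma finite_alg_over x z : finite_over (rational_subfield iota x) ->
  alg_over x z.
Proof.
move=> [n [b bP]].
have /choice[c cP] (i : 'I_n) : exists c : 'I_n -> ratfield x,
    z * b i = \sum_(j < n) val (c j) * b j.
  have [c [cP ->]] := bP (z * b i).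
  exists (fun j => Sub (c j) (asboolT (cP j))).
  by apply: eq_bigr => j _; rewrite SubK.
pose C : 'M_n := \matrix_(i, j) c j i.
exists (char_poly C); first by rewrite monic_neq0 ?char_poly_monic.
rewrite map_char_poly -eigenvalue_root_char.
apply/eigenvalueP; exists (\row_j b j).
  apply/rowP => i; rewrite !mxE cP; apply: eq_bigr => j _.
  by rewrite !mxE mulrC.
(* The family need not be independent, but it is not all zero because it spans 1. *)
apply/eqP => b0; have [c1 [_ E1]] := bP 1.
move/eqP: E1; rewrite big1 ?oner_eq0 // => j _.
by have /rowP/(_ j) := b0; rewrite !mxE => ->; rewrite mulr0.
Qed.

Hypothesis FF : function_field iota.

(** The transcendence degree is one: the given [x] is algebraic over k(u) by exchange, and [z] is
    algebraic over k(x). *)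
Lemma alg_over_transcendental u z : transcendental iota u -> alg_over u z.
Proof.
case: FF => -[x [tx fx]] _ tu; apply: (@alg_over_trans _ x).
  exact/alg_over_swap/finite_alg_over.
exact: finite_alg_over.
Qed.

Lemma not_transcendental z : ~ transcendental iota z -> exists a, z = iota a.
Proof. by move=> /contrapT; apply: FF.2. Qed.

End RationalSubfield.

(** * Separating elements *)

(* [SepRoot] allows coefficients in the closure itself, which builds the
   transitivity of separability into the definition. *)
Inductive sep_closure (k F : fieldType) (iota : {rmorphism k -> F}) (x : F) :
  F -> Prop :=
| SepConst a : sep_closure iota x (iota a)
| SepVar : sep_closure iota x x
| SepB u v : sep_closure iota x u -> sep_closure iota x v ->
    sep_closure iota x (u - v)
| SepM u v : sep_closure iota x u -> sep_closure iota x v ->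
    sep_closure iota x (u * v)
| SepV u : sep_closure iota x u -> sep_closure iota x u^-1
| SepRoot (f : {poly F}) b : (forall i, sep_closure iota x f`_i) ->
    f.[b] = 0 -> f^`().[b] != 0 -> sep_closure iota x b.

Section Separating.
Variables (k F : fieldType) (iota : {rmorphism k -> F}).
Implicit Types (x y z : F).

Lemma sep_closure_trans x y z :
  sep_closure iota x y -> sep_closure iota y z -> sep_closure iota x z.
Proof.
move=> xy; elim=> *; [exact: SepConst|exact: xy|exact: SepB|exact: SepM
  |exact: SepV|exact: SepRoot].
Qed.

(** Induction principle: the constants, [x0] and the [b i] generate F as a field. *)
Lemma generated_ind (x0 : F) n (b : 'I_n -> F)
  (bP : forall z, exists c : 'I_n -> F,
     (forall i, rational_subfield iota x0 (c i)) /\ z = \sum_(i < n) c i * b i)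
  (T : F -> Prop) : (forall a, T (iota a)) -> T x0 -> (forall i, T (b i)) ->
  (forall u v, T u -> T v -> T (u - v)) ->
  (forall u v, T u -> T v -> T (u * v)) -> (forall u, T u -> T u^-1) ->
  forall z, T z.
Proof.
move=> Tc Tx Tb TB TM TV z.
have T0 : T 0 by rewrite -(rmorph0 iota).
have TD u v : T u -> T v -> T (u + v).
  by move=> Tu Tv; rewrite -[v]opprK -[- v]sub0r; do 2?apply: (TB) => //.
have Tev f : T (eval_at iota x0 f).
  elim/poly_ind: f => [|f c IH]; first by rewrite rmorph0.
  rewrite rmorphD rmorphM /= eval_atX eval_atC; apply: TD => //.
  exact: TM.
have [c [cP ->]] := bP z; apply: (big_ind T) => // i _; apply: (TM) => //.
by have /rational_subfieldP[f [g [_ ->]]] := cP i; apply: (TM) => //; apply: TV.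
Qed.

(** Sparse form of a polynomial relation: exponents can be lowered or divided by [p] term by term
    over a fixed index set, and both variables are treated alike. *)
Definition bivariate (I : finType) (a : I -> k) (e1 e2 : I -> nat) x z :=
  \sum_i iota (a i) * x ^+ e1 i * z ^+ e2 i.

Lemma bivariateC (I : finType) (a : I -> k) e1 e2 x z :
  bivariate a e1 e2 x z = bivariate a e2 e1 z x.
Proof. by apply: eq_bigr => i _; rewrite mulrAC. Qed.

Lemma bivariate_sep (I : finType) (a : I -> k) e1 e2 x z :
  bivariate a e1 e2 x z = 0 ->
  bivariate (fun i => a i * (e2 i)%:R) e1 (fun i => (e2 i).-1) x z != 0 ->
  sep_closure iota x z.
Proof.
move=> val0 der0.
pose f : {poly F} := \sum_i (iota (a i) * x ^+ e1 i) *: 'X^(e2 i).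
apply: (@SepRoot _ _ _ _ f).
- have S0 : sep_closure iota x 0 by rewrite -(rmorph0 iota); apply: SepConst.
  have S1 : sep_closure iota x 1 by rewrite -(rmorph1 iota); apply: SepConst.
  have SD u v : sep_closure iota x u -> sep_closure iota x v ->
      sep_closure iota x (u + v).
    move=> xu xv; rewrite -[v]opprK -[- v]sub0r.
    by do 2?apply: (SepB) => //.
  move=> j; rewrite coef_sum; apply: (big_ind (sep_closure iota x)) => // i _.
  rewrite coefZ coefXn; apply: SepM; last by case: (j == e2 i).
  apply: SepM; first exact: SepConst.
  elim: (e1 i) => [|d IH]; first by rewrite expr0.
  by rewrite exprS; apply: SepM => //; apply: SepVar.
- rewrite -val0 horner_sum; apply: eq_bigr => i _.
  by rewrite hornerZ hornerXn.
- rewrite [_.[_]](_ : _ = bivariate (fun i => a i * (e2 i)%:R) e1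
    (fun i => (e2 i).-1) x z) // raddf_sum horner_sum; apply: eq_bigr => i _.
  rewrite /= derivZ derivXn hornerZ hornerMn hornerXn rmorphM rmorph_nat.
  by rewrite -mulr_natr; ring.
Qed.

(** The sum of the degrees of the nonzero terms is the induction measure. Differentiation adds no
    terms and lowers the exponent of the surviving term [i0]. *)
Lemma degree_deriv (I : finType) (a : I -> k) (e1 e2 : I -> nat) i0 :
  a i0 * (e2 i0)%:R != 0 ->
  (\sum_(i | (a i * (e2 i)%:R != 0)%R) (e1 i + (e2 i).-1) <
   \sum_(i | a i != 0%R) (e1 i + e2 i))%N.
Proof.
move=> ai0; have a0 : a i0 != 0 by apply: contraNneq ai0 => ->; rewrite mul0r.
have e0 : (0 < e2 i0)%N.
  by rewrite lt0n; apply: contraNneq ai0 => ->; rewrite mulr0.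
rewrite (bigD1 i0) //= [X in (_ < X)%N](bigD1 i0) //= -addSn leq_add //.
  by rewrite -addnS prednK.
rewrite big_mkcond [X in (_ <= X)%N]big_mkcond leq_sum // => i _.
case: (eqVneq (a i) 0) => [->|_]; first by rewrite mul0r eqxx.
by case: ifP => [/andP[_ ->]|_]; rewrite ?leq_add2l ?leq_pred.
Qed.

End Separating.

(** * Separating elements over a finite constant field *)

Section FiniteField.
Variables (p m : nat) (k : finFieldType).
Hypotheses (p_prime : prime p) (m_gt0 : (0 < m)%N) (card_k : #|k| = (p ^ m)%N).
Variables (F : fieldType) (iota : {rmorphism k -> F}).
Implicit Types (x y z : F).

Lemma pcharF : p \in [pchar F].
Proof. exact/(rmorph_pchar iota)/(card_finPcharP card_k p_prime). Qed.

(* If both partial derivatives of a bivariate relation vanish, the relation is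
   a [p]-th power since [k] is perfect; so a relation of minimal degree has a
   nonzero partial derivative at [(x, z)]. *)
Lemma relation_sep (I : finType) (a : I -> k) (e1 e2 : I -> nat) x z :
  (exists i, a i != 0) ->
  (forall i j, a i != 0 -> a j != 0 -> e1 i = e1 j -> e2 i = e2 j -> i = j) ->
  bivariate iota a e1 e2 x z = 0 ->
  sep_closure iota x z \/ sep_closure iota z x.
Proof.
have [n] := ubnP (\sum_(i | a i != 0%R) (e1 i + e2 i))%N.
elim: n a e1 e2 x z => // n IH a e1 e2 x z.
(* If the formal derivative in the second variable is nonzero, either its value is nonzero and the
   root is simple, or it is a smaller relation. *)
have half (b : I -> k) d1 d2 u v :
    (\sum_(i | b i != 0%R) (d1 i + d2 i) < n.+1)%N ->
    (forall i j, b i != 0 -> b j != 0 -> d1 i = d1 j -> d2 i = d2 j -> i = j) ->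
    bivariate iota b d1 d2 u v = 0 -> (exists i, b i * (d2 i)%:R != 0) ->
    sep_closure iota u v \/ sep_closure iota v u.
  move=> lt_n inj val0 [i0 di0].
  have [der0|der0] := eqVneq (bivariate iota
    (fun i => b i * (d2 i)%:R) d1 (fun i => (d2 i).-1) u v) 0; last first.
    by left; apply: bivariate_sep der0.
  apply: (IH _ _ _ _ _ _ _ _ der0); [|by exists i0|].
    exact: leq_trans (degree_deriv d1 di0) _.
  (* Terms that survive differentiation have positive exponent, so the truncated predecessor keeps
     the exponent pairs distinct. *)
  move=> i j; have nz l : b l * (d2 l)%:R != 0 -> (b l != 0) && (0 < d2 l)%N.
    by rewrite mulf_eq0 negb_or lt0n => /andP[-> ]; apply: contraNneq => ->.
  move=> /nz/andP[bi di] /nz/andP[bj dj] e1ij e2ij; apply: inj => //.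
  by rewrite -(prednK di) -(prednK dj) e2ij.
move=> lt_n nz inj val0.
have [|nd2] := pselect (exists i, a i * (e2 i)%:R != 0).
  exact: half lt_n inj val0.
have [d1|nd1] := pselect (exists i, a i * (e1 i)%:R != 0).
  apply/or_comm; apply: (half a e2 e1) => //; last by rewrite bivariateC.
    by under eq_bigr do rewrite addnC.
  by move=> i j ai aj e2ij e1ij; apply: inj.
have pk := card_finPcharP card_k p_prime.
have dvd (e : I -> nat) i : ~ (exists i, a i * (e i)%:R != 0) -> a i != 0 ->
    (p %| e i)%N.
  move=> nd ai; rewrite (dvdn_pcharf pk); apply/negP => /negP ei.
  by apply: nd; exists i; rewrite mulf_neq0.
have [i0 ai0] := nz.
have p0 := prime_gt0 p_prime.
(* The [p]-th root of [c] is [c ^+ (p ^ m.-1)], because [c ^+ #|k| = c]. *)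
have rootE c : (c ^+ (p ^ m.-1)) ^+ p = c :> k.
  by rewrite -exprM -expnSr prednK // -card_k expf_card.
have nzr c : (c ^+ (p ^ m.-1) != 0) = (c != 0 :> k).
  by rewrite expf_eq0 expn_gt0 p0.
apply: (IH (fun i => a i ^+ (p ^ m.-1)) (fun i => e1 i %/ p)%N
  (fun i => e2 i %/ p)%N).
- rewrite ltnS in lt_n; under eq_bigl do rewrite nzr.
  apply: (leq_trans _ lt_n).
  have [[i1 ai1 ei1]|e0] := pselect (exists2 i, a i != 0 & (0 < e1 i + e2 i)%N).
    rewrite (bigD1 i1) //= [X in (_ < X)%N](bigD1 i1) //= -addSn leq_add //.
      have [/dvdnP[c1 c1E] /dvdnP[c2 c2E]] := (dvd _ _ nd1 ai1, dvd _ _ nd2 ai1).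
      by move: ei1 (prime_gt1 p_prime); rewrite c1E c2E !mulnK //; nia.
    by apply: leq_sum => i _; rewrite leq_add // leq_div.
  (* Otherwise every nonzero term has degree zero; distinctness leaves a single term, a nonzero
     constant, which cannot vanish. *)
  exfalso; move: val0; rewrite /bivariate (bigD1 i0) //= big1; last first.
    move=> i ii0; have [->|ai] := eqVneq (a i) 0.
      by rewrite rmorph0 !mul0r.
    case/eqP: ii0; have z0 l : a l != 0 -> e1 l = 0%N /\ e2 l = 0%N.
      move=> al; have /negP : ~ (0 < e1 l + e2 l)%N.
        by move=> ?; apply: e0; exists l.
      by rewrite -eqn0Ngt addn_eq0 => /andP[/eqP-> /eqP->].
    have [? ?] := z0 _ ai; have [? ?] := z0 _ ai0.
    by apply: inj => //; congruence.
  have : (e1 i0 + e2 i0 == 0)%N.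
    by rewrite eqn0Ngt; apply/negP => ?; apply: e0; exists i0.
  rewrite addn_eq0 => /andP[/eqP-> /eqP->]; rewrite !expr0 !mulr1 addr0.
  by move/eqP; rewrite fmorph_eq0 (negPf ai0).
- by exists i0; rewrite nzr.
- move=> i j; rewrite !nzr => ai aj e1ij e2ij; apply: inj => //.
    by rewrite -(divnK (dvd _ _ nd1 ai)) e1ij divnK // dvd.
  by rewrite -(divnK (dvd _ _ nd2 ai)) e2ij divnK // dvd.
- apply/eqP; set B := bivariate _ _ _ _ _ _.
  suff : B ^+ p == 0 by rewrite expf_eq0 => /andP[].
  rewrite -(pFrobenius_autE pcharF) raddf_sum; apply/eqP; rewrite -[RHS]val0.
  apply: eq_bigr => i _ /=.
  rewrite pFrobenius_autE !exprMn -rmorphXn rootE.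
  have [->|ai] := eqVneq (a i) 0; first by rewrite rmorph0 !mul0r.
  by rewrite -!exprM !divnK // dvd.
Qed.

Hypothesis FF : function_field iota.

Lemma sep_or_sep x z : transcendental iota x ->
  sep_closure iota x z \/ sep_closure iota z x.
Proof.
move=> tx; have /alg_over_relation[G G0 Gz] := alg_over_transcendental FF z tx.
(* A common bound on the sizes of the coefficients lets a rectangle index the terms of [G]; the
   padding has coefficient zero. *)
pose B := (\max_(j < size G) size (G`_j)%R)%N.
have leB (j : 'I_(size G)) : (size (G`_j)%R <= B)%N.
  exact: (@leq_bigmax_cond _ xpredT (fun j : 'I_(size G) => size (G`_j)%R) j isT).
apply: (@relation_sep _ (fun ij : 'I_B * 'I_(size G) => G`_(ij.2)`_(ij.1))
  (fun ij => ij.1) (fun ij => ij.2)).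
- have G2 : ((size G).-1 < size G)%N by rewrite prednK ?size_poly_gt0.
  have G4 : ((size (lead_coef G)).-1 < B)%N.
    rewrite prednK ?size_poly_gt0 ?lead_coef_eq0 //.
    exact: leB (Ordinal G2).
  exists (Ordinal G4, Ordinal G2) => /=.
  by rewrite -[G`_ _]lead_coefE -lead_coefE !lead_coef_eq0.
- by move=> [i1 i2] [j1 j2] _ _ /= /val_inj-> /val_inj->.
- rewrite -[RHS]Gz (@horner_coef_wide _ (size G)) ?size_poly // /bivariate.
  rewrite -(pair_bigA _ (fun (i : 'I_B) (j : 'I_(size G)) =>
    iota G`_j`_i * x ^+ i * z ^+ j)) exchange_big /=; apply: eq_bigr => j _.
  rewrite coef_map -mulr_suml; congr (_ * _).
  rewrite /= /eval_at /horner_morph (@horner_coef_wide _ B).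
    by apply: eq_bigr => i _; rewrite coef_map.
  by rewrite (leq_trans (size_poly _ _)) ?leB.
Qed.

(** The elements are absorbed one by one: if [z] is not separable over the current [x], then [x] is
    separable over [z], and [z] takes its place. *)
Lemma sep_closure_seq x0 (s : seq F) : transcendental iota x0 ->
  exists2 x, transcendental iota x &
    sep_closure iota x x0 /\ forall z, z \in s -> sep_closure iota x z.
Proof.
move=> tx0; elim: s => [|z s [x tx [xx0 xs]]].
  by exists x0 => //; split=> //; apply: SepVar.
have [xz|[tz zx]] : sep_closure iota x z \/
    transcendental iota z /\ sep_closure iota z x.
- have [tz|/(not_transcendental FF)[a ->]] := pselect (transcendental iota z).
    by case: (sep_or_sep z tx) => H; [left|right].
  by left; apply: SepConst.
- exists x => //; split=> // w; rewrite inE => /predU1P[->//|]; exact: xs.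
- exists z => //; split; first exact: sep_closure_trans zx xx0.
  move=> w; rewrite inE => /predU1P[->|/xs xw]; first exact: SepVar.
  exact: sep_closure_trans zx xw.
Qed.

Lemma separating_element :
  exists2 x, transcendental iota x & forall z, sep_closure iota x z.
Proof.
have [[x0 [tx0 [n [b bP]]]] _] := FF.
have [x tx [xx0 xb]] := sep_closure_seq (codom b) tx0.
exists x => //; apply: (generated_ind bP) => //.
- exact: SepConst.
- by move=> i; apply: xb; rewrite codom_f.
- exact: SepB.
- exact: SepM.
- exact: SepV.
Qed.

End FiniteField.

(** * Valuation rings *)

Definition vpred (k F : fieldType) (iota : {rmorphism k -> F}) (E O : set F)
  (VO : valuation_ring iota E O) : {pred F} := fun z => `[< O z >].

(** The clause [u != 0] excludes 0, whose formal inverse is 0 and lies in [O]. *)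
Definition vunit (F : fieldType) (O : set F) (u : F) : Prop :=
  [/\ u != 0, O u & O u^-1].

Definition vmax (F : fieldType) (O : set F) (z : F) : Prop :=
  O z /\ ~ vunit O z.

Section ValuationRing.
Variables (k F : fieldType) (iota : {rmorphism k -> F}) (E O : set F).
Hypothesis VO : valuation_ring iota E O.
Implicit Types (x z u w : F).

Lemma vpred_subring : subring_closed (vpred VO).
Proof.
split=> [|x z /asboolP Ox /asboolP Oz|x z /asboolP Ox /asboolP Oz];
  apply/asboolP; [exact: valuation_ring1 VO|exact: (valuation_ringB VO)
                 |exact: (valuation_ringM VO)].
Qed.

HB.instance Definition _ :=
  GRing.isSubringClosed.Build F (vpred VO) vpred_subring.

Lemma vpredE z : (z \in vpred VO) = `[< O z >]. Proof. by []. Qed.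

Lemma vpredP z : O z <-> z \in vpred VO.
Proof. by rewrite vpredE; split=> /asboolP. Qed.

Lemma vring_const a : O (iota a).
Proof. by case: (valuation_ring_const VO) => + _; apply; exists a. Qed.

Lemma vring_sub z : O z -> E z.
Proof. by case: (valuation_ring_proper VO) => + _; apply. Qed.

Lemma vring_proper : exists2 z, E z & ~ O z.
Proof.
case: (valuation_ring_proper VO) => _ nEO; apply: contrapT => nz; apply: nEO.
by move=> z Ez; apply: contrapT => nOz; apply: nz; exists z.
Qed.

Lemma vring0 : O 0. Proof. by apply/vpredP; rewrite rpred0. Qed.
Lemma vring1 : O 1. Proof. by apply/vpredP; rewrite rpred1. Qed.
Lemma vringN z : O z -> O (- z).
Proof. by rewrite !vpredP; apply: rpredNr. Qed.
Lemma vringD x z : O x -> O z -> O (x + z).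
Proof. by rewrite !vpredP; apply: rpredD. Qed.
Lemma vringB x z : O x -> O z -> O (x - z).
Proof. by rewrite !vpredP; apply: rpredB. Qed.
Lemma vringM x z : O x -> O z -> O (x * z).
Proof. by rewrite !vpredP; apply: rpredM. Qed.
Lemma vringX x n : O x -> O (x ^+ n).
Proof. by rewrite !vpredP; apply: rpredX. Qed.

Lemma vunit1 : vunit O 1.
Proof. by split; rewrite ?oner_neq0 ?invr1 //; apply: vring1. Qed.
Lemma vunitV u : vunit O u -> vunit O u^-1.
Proof. by case=> u0 Ou OV; split; rewrite ?invr_eq0 ?invrK. Qed.
Lemma vunitM u w : vunit O u -> vunit O w -> vunit O (u * w).
Proof.
by case=> u0 Ou OuV [w0 Ow OwV]; split; rewrite ?mulf_neq0 ?invfM //;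
  apply: vringM.
Qed.
Lemma vunitX u n : vunit O u -> vunit O (u ^+ n).
Proof.
move=> Uu; elim: n => [|n IH]; first by rewrite expr0; apply: vunit1.
by rewrite exprS; apply: vunitM.
Qed.
Lemma vunit_const a : a != 0 -> vunit O (iota a).
Proof. by split; rewrite -?fmorphV ?fmorph_eq0 //; apply: vring_const. Qed.
Lemma vunitMl a b : O a -> O b -> vunit O (a * b) -> vunit O a.
Proof.
move=> Oa Ob [ab0 _ OV]; have := ab0; rewrite mulf_eq0 negb_or => /andP[a0 b0].
split=> //; rewrite (_ : a^-1 = b * (a * b)^-1); first exact: vringM.
by field; rewrite a0 b0.
Qed.

Lemma vmax0 : vmax O 0.
Proof. by split; [exact: vring0|case=> /eqP]. Qed.
Lemma vmax_nunit z : vmax O z -> ~ vunit O z. Proof. by case. Qed.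
Lemma vmaxW z : vmax O z -> O z. Proof. by case. Qed.
Lemma vunit_or_vmax z : O z -> vunit O z \/ vmax O z.
Proof. by move=> Oz; have [|nU] := pselect (vunit O z); [left|right]. Qed.
Lemma vmaxMr a z : O a -> vmax O z -> vmax O (z * a).
Proof.
by move=> Oa [Oz nU]; split; [exact: vringM|apply: contra_not nU; apply: vunitMl].
Qed.
Lemma vmaxMl a z : O a -> vmax O z -> vmax O (a * z).
Proof. by rewrite mulrC; apply: vmaxMr. Qed.
Lemma vmaxN z : vmax O z -> vmax O (- z).
Proof. by rewrite -mulN1r; apply/vmaxMl/vringN/vring1. Qed.
Lemma vmaxX z n : O z -> vmax O (z ^+ n) -> vmax O z.
Proof. by move=> Oz [_ nU]; split=> //; apply: contra_not nU; apply: vunitX. Qed.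

Hypothesis Ediv : forall x z, E x -> E z -> E (x / z).

Lemma vmaxV z : E z -> ~ O z -> vmax O z^-1.
Proof.
move=> Ez nOz; have [//|OV] := valuation_ring_inv VO Ez.
by split=> // -[_ _]; rewrite invrK.
Qed.

Lemma vmaxD z w : vmax O z -> vmax O w -> vmax O (z + w).
Proof.
move=> Mz Mw; split; first by apply: vringD; apply: vmaxW.
(* One of z/w and w/z lies in [O], so one summand can be factored out of the sum. *)
wlog Ozw : z w Mz Mw / O (z / w).
  move=> H; have [?|Owz] := valuation_ring_inv VO
    (Ediv (vring_sub (vmaxW Mz)) (vring_sub (vmaxW Mw))); first exact: H.
  by rewrite addrC; apply: H => //; rewrite -invf_div.
have [->|w0] := eqVneq w 0; first by rewrite addr0; exact: vmax_nunit.
rewrite (_ : z + w = w * (z / w + 1)); last by field.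
by move/vunitMl => /(_ (vmaxW Mw)) H; apply: (vmax_nunit Mw);
   apply: H; apply: vringD => //; exact: vring1.
Qed.

Lemma vmaxB z w : vmax O z -> vmax O w -> vmax O (z - w).
Proof. by move=> Mz /vmaxN; apply: vmaxD. Qed.

Lemma vunitD u z : vunit O u -> vmax O z -> vunit O (u + z).
Proof.
move=> Uu Mz; have [_ Ou _] := Uu.
have [//|Muz] := vunit_or_vmax (vringD Ou (vmaxW Mz)).
by case: (vmax_nunit (vmaxB Muz Mz)); rewrite addrK.
Qed.

(** If [z] were outside [O], its inverse would lie in [O], and dividing the equation by a power of
    [z] would express [z] as a polynomial in that inverse. *)
Lemma vring_integrally_closed (p : {poly F}) z : E z ->
  (forall i, O p`_i) -> vunit O (lead_coef p) -> p.[z] = 0 -> O z.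
Proof.
move=> Ez Op Up pz0; apply: contrapT => nOz.
have OV := vmaxW (vmaxV Ez nOz).
have z0 : z != 0 by apply: contra_notN nOz => /eqP->; exact: vring0.
have [lp0 _ _] := Up; have p0 : p != 0 by rewrite -lead_coef_eq0.
case Dn: (size p) => [|[|n]].
- by move/eqP: Dn; rewrite size_poly_eq0 (negPf p0).
- have /eqP/size_poly1P[c c0 pc] := Dn.
  by move: pz0; rewrite pc hornerC => /eqP; rewrite (negPf c0).
move/eqP: pz0; rewrite horner_coef Dn big_ord_recr /= addrC addr_eq0.
have -> : p`_n.+1 = lead_coef p by rewrite lead_coefE Dn.
move=> /eqP pz; apply: nOz.
rewrite (_ : z = - (lead_coef p)^-1 * \sum_(i < n.+1) (p`_i * z^-1 ^+ (n - i))).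
  apply/vpredP; apply: rpredM; first by rewrite rpredNr // -vpredP; case: Up.
  apply: rpred_sum => i _; apply: rpredM; first exact/vpredP.
  exact/rpredX/vpredP.
apply: (mulfI lp0); rewrite mulrA mulrN mulfV // mulN1r.
apply: (mulIf (expf_neq0 n z0)); rewrite -mulrA -exprS pz mulNr; congr (- _).
rewrite mulr_suml; apply: eq_bigr => i _; rewrite -mulrA; congr (_ * _).
have le_in : (i <= n)%N by rewrite -ltnS.
by rewrite -[in z ^+ n](subnK le_in) exprD mulrA -exprMn mulVf // expr1n mul1r.
Qed.

Lemma vring_eval z (c : {poly k}) : O z -> O (eval_at iota z c).
Proof.
move=> /vpredP Oz; elim/poly_ind: c => [|c a IH].
  by rewrite rmorph0; apply: vring0.
rewrite rmorphD rmorphM /= eval_atX eval_atC.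
by apply: vringD; [apply: vringM => //; apply/vpredP|apply: vring_const].
Qed.

(** A polynomial [h] of least size works, by Euclidean division; up to a constant it is the minimal
    polynomial of the residue of [z]. *)
Lemma vmax_min_poly z : O z -> (exists2 c, c != 0 & vmax O (eval_at iota z c)) ->
  exists h : {poly k}, [/\ (1 < size h)%N, vmax O (eval_at iota z h) &
    forall c, vmax O (eval_at iota z c) -> h %| c].
Proof.
move=> Oz [c0 c00 Mc0].
pose P n := `[< exists c : {poly k}, [/\ c != 0, size c = n &
  vmax O (eval_at iota z c)] >].
have exP : exists n, P n by exists (size c0); apply/asboolP; exists c0.
have [n /asboolP[h [h0 sh Mh]] min_n] := ex_minnP exP.
exists h; split=> // [|c Mc].
  rewrite ltnNge; apply/negP => /size1_polyC hC; move: Mh h0.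
  by rewrite hC eval_atC polyC_eq0 => /vmax_nunit H /vunit_const.
have rE : c %% h = c - c %/ h * h.
  by apply/eqP; rewrite eq_sym subr_eq addrC -divp_eq.
apply: contrapT => /negP; rewrite /dvdp => r0.
have := ltn_modp c h; rewrite h0 sh ltnNge min_n //; apply/asboolP.
exists (c %% h); split=> //; rewrite rE rmorphB rmorphM /=; apply: vmaxB => //.
by apply: vmaxMl => //; apply: vring_eval.
Qed.

End ValuationRing.

(** * Frobenius powers modulo polynomials and on residues *)

Section Frobenius.
Variables (p m : nat) (k : finFieldType).
Hypotheses (p_prime : prime p) (card_k : #|k| = (p ^ m)%N).
Local Notation q := #|k|.

Lemma frobD (R : comNzRingType) (x y : R) j : p \in [pchar R] ->
  (x + y) ^+ (q ^ j) = x ^+ (q ^ j) + y ^+ (q ^ j).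
Proof.
move=> pR; apply: exprDn_pchar; rewrite card_k -expnM.
by rewrite pnatX pnatE // pR.
Qed.

Lemma frobB (R : comNzRingType) (x y : R) j : p \in [pchar R] ->
  (x - y) ^+ (q ^ j) = x ^+ (q ^ j) - y ^+ (q ^ j).
Proof. by move=> pR; apply/eqP; rewrite eq_sym subr_eq -frobD // subrK. Qed.

Lemma q_gt1 : (1 < q)%N. Proof. exact: finNzRing_gt1. Qed.

Lemma const_frob (F : fieldType) (iota : {rmorphism k -> F}) a j :
  iota a ^+ (q ^ j) = iota a.
Proof.
rewrite -rmorphXn; congr (iota _); elim: j => [|j IH]; first by rewrite expr1.
by rewrite expnS exprM expf_card.
Qed.

(** There are finitely many remainders modulo [h], so two powers ['X^(q ^ i)] and ['X^(q ^ j)]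
    agree; their difference is a [q ^ i]-th power. *)
Lemma dvdp_frobenius (h : {poly k}) : h != 0 ->
  exists j i, (0 < j)%N /\ h %| ('X^(q ^ j) - 'X) ^+ (q ^ i).
Proof.
move=> h0; pose f i := poly_rV ('X^(q ^ i) %% h) : 'rV[k]_(size h).
have [/injectiveP inj|/injectivePn] :=
    boolP (injectiveb (fun i : 'I_(#|{: 'rV[k]_(size h)}|.+1) => f i)).
  by have := leq_card _ inj; rewrite card_ord ltnn.
move=> [i [j ij fij]].
wlog lt_ij : i j ij fij / (i < j)%N.
  move=> H; case: (ltngtP i j) => [lt|lt|/val_inj/eqP]; last by rewrite (negPf ij).
    exact: H lt.
  by apply: (H j i) => //; rewrite eq_sym.
exists (j - i)%N, i; rewrite subn_gt0; split=> //.
have pk := card_finPcharP card_k p_prime.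
rewrite frobB ?pchar_poly // -exprM -expnD subnK 1?ltnW //.
rewrite /dvdp modpD modpN subr_eq0; move/(congr1 rVpoly): fij.
by rewrite !poly_rV_K ?(ltnW (ltn_modpN0 _ h0)) // => ->.
Qed.

(** The residue of [z] is a root of [c], hence fixed by a power of Frobenius. All multiples of [j]
    are allowed so that exponents found for different elements can be matched. *)
Lemma vmax_frob (F : fieldType) (iota : {rmorphism k -> F}) (E O : set F)
    (VO : valuation_ring iota E O) z (c : {poly k}) :
    (forall x z, E x -> E z -> E (x / z)) ->
    O z -> c != 0 -> vmax O (eval_at iota z c) ->
  exists2 j, (0 < j)%N & forall i, vmax O (z ^+ (q ^ (j * i)) - z).
Proof.
move=> Ediv Oz /dvdp_frobenius[j [i [j0 /dvdpP[d dE]]]] Mc; exists j => // n.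
have pF := pcharF p_prime card_k iota.
have Mj : vmax O (z ^+ (q ^ j) - z).
  apply: (vmaxX VO (n := (q ^ i)%N)).
    by apply: (vringB VO) => //; apply: (vringX VO).
  have := congr1 (eval_at iota z) dE.
  rewrite rmorphXn rmorphB rmorphM rmorphXn /= eval_atX => ->.
  by apply: (vmaxMl VO) => //; apply: (vring_eval VO).
elim: n => [|n IH]; first by rewrite muln0 expn0 expr1 subrr; apply: (vmax0 VO).
(* The difference splits as a [q ^ j]-th power of the previous one plus [z ^+ (q ^ j) - z]. *)
rewrite mulnS addnC expnD exprM -(subrKA (z ^+ (q ^ j))) -frobB //.
apply: (vmaxD VO) => //; rewrite -(prednK (_ : 0 < q ^ j)%N); last first.
  by rewrite expn_gt0 ltnW ?q_gt1.
rewrite exprS; apply: (vmaxMr VO) => //; apply: (vringX VO).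
exact: vmaxW IH.
Qed.

End Frobenius.

(** * The local ring at a good place *)

(** Local counterpart of [sep_closure]: inverses and derivatives at roots are required to be units
    of [O], which keeps the ring inside [O] and its generators simple modulo the place. *)
Inductive etale_closure (k F : fieldType) (iota : {rmorphism k -> F}) (x : F)
  (O : set F) : F -> Prop :=
| EtConst a : etale_closure iota x O (iota a)
| EtVar : etale_closure iota x O x
| EtB u v : etale_closure iota x O u -> etale_closure iota x O v ->
    etale_closure iota x O (u - v)
| EtM u v : etale_closure iota x O u -> etale_closure iota x O v ->
    etale_closure iota x O (u * v)
| EtV u : etale_closure iota x O u -> vunit O u -> etale_closure iota x O u^-1
| EtRoot (f : {poly F}) b : (forall i, etale_closure iota x O f`_i) -> O b ->
    f.[b] = 0 -> vunit O f^`().[b] -> etale_closure iota x O b.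

Definition etpred (k F : fieldType) (iota : {rmorphism k -> F}) (x : F)
  (O : set F) : {pred F} := fun z => `[< etale_closure iota x O z >].

(* [P] holds at all but finitely many places of [F/k] with [x] in [O]. *)
Definition almost_everywhere (k F : fieldType) (iota : {rmorphism k -> F})
  (x : F) (P : set F -> Prop) : Prop :=
  exists2 d : {poly k}, d != 0 & forall O : set F,
    valuation_ring iota [set: F] O -> O x -> vunit O (eval_at iota x d) -> P O.

(** * Conditions holding at almost all places *)

Section AlmostEverywhere.
Variables (k F : fieldType) (iota : {rmorphism k -> F}) (x : F).
Local Notation ae := (almost_everywhere iota x).

Lemma ae_all (P : set F -> Prop) :
  (forall O, valuation_ring iota [set: F] O -> O x -> P O) -> ae P.
Proof. by move=> HP; exists 1 => [|O VO Ox _]; [exact: oner_neq0|exact: HP]. Qed.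

Lemma ae_impl (P Q : set F -> Prop) :
  (forall O, valuation_ring iota [set: F] O -> O x -> P O -> Q O) ->
  ae P -> ae Q.
Proof.
by move=> PQ [d d0 dP]; exists d => // O VO Ox Ud; apply: PQ => //; apply: dP.
Qed.

Lemma ae_and (P Q : set F -> Prop) : ae P -> ae Q -> ae (fun O => P O /\ Q O).
Proof.
move=> [d d0 dP] [e e0 eQ]; exists (d * e); first by rewrite mulf_neq0.
move=> O VO Ox; rewrite rmorphM => Ude.
have Od := vring_eval VO d Ox; have Oe := vring_eval VO e Ox; split.
  by apply: dP => //; apply: (vunitMl VO Od Oe).
by apply: eQ => //; apply: (vunitMl VO Oe Od); rewrite mulrC.
Qed.

Lemma ae_forall n (P : nat -> set F -> Prop) :
  (forall i, ae (P i)) -> ae (fun O => forall i, (i < n)%N -> P i O).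
Proof.
move=> aeP; elim: n => [|n IH]; first exact: ae_all.
have := ae_and IH (aeP n); apply: ae_impl => O _ _ [H Hn] i.
by rewrite ltnS leq_eqVlt => /predU1P[->//|]; apply: H.
Qed.

End AlmostEverywhere.

Section EtaleClosure.
Variables (k F : fieldType) (iota : {rmorphism k -> F}) (x : F) (O : set F).
Local Notation et := (etale_closure iota x O).

Lemma etpred_subring : subring_closed (etpred iota x O).
Proof.
split=> [|a b /asboolP ea /asboolP eb|a b /asboolP ea /asboolP eb];
  apply/asboolP; [by rewrite -(rmorph1 iota); exact: EtConst|exact: EtB
                 |exact: EtM].
Qed.

HB.instance Definition _ :=
  GRing.isSubringClosed.Build F (etpred iota x O) etpred_subring.

Lemma etP z : et z <-> z \in etpred iota x O.
Proof. by split=> /asboolP. Qed.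

Lemma et_eval c : et (eval_at iota x c).
Proof.
elim/poly_ind: c => [|c a IH].
  by rewrite rmorph0 -(rmorph0 iota); apply: EtConst.
rewrite rmorphD rmorphM /= eval_atX eval_atC etP rpredD //.
  by rewrite rpredM // -etP //; apply: EtVar.
by rewrite -etP; apply: EtConst.
Qed.

Lemma et_vring z : valuation_ring iota [set: F] O -> O x -> et z -> O z.
Proof.
move=> VO Ox; elim=> //.
- exact: vring_const VO.
- by move=> u v _ Ou _ Ov; apply: (vringB VO).
- by move=> u v _ Ou _ Ov; apply: (vringM VO).
- by move=> u _ _ [].
Qed.

(** The remainder is built along Horner's scheme, without dividing by 2, so it stays in [S] in every
    characteristic. *)
Lemma poly_taylor2 (S : subringClosed F) (f : {poly F}) b s :
  (forall i, f`_i \in S) -> b \in S -> s \in S ->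
  exists2 c, c \in S & f.[b + s] = f.[b] + f^`().[b] * s + s ^+ 2 * c.
Proof.
move=> Sf Sb Ss; elim/poly_ind: f Sf => [|f a IH] Sf.
  by exists 0; rewrite ?rpred0 // deriv0 !horner0 !mul0r mulr0 !addr0.
have Sf' i : f`_i \in S by have := Sf i.+1; rewrite coefD coefMX coefC addr0.
have [c Sc fE] := IH Sf'.
have Sdf : f^`().[b] \in S.
  by apply: rpred_horner => //; apply/polyOver_deriv/polyOverP.
exists (f^`().[b] + c * (b + s)); first by rewrite rpredD ?rpredM ?rpredD.
rewrite derivD derivM derivX derivC !hornerE fE; ring.
Qed.

End EtaleClosure.

Section FunctionField.
Variables (p m : nat) (k : finFieldType).
Hypotheses (p_prime : prime p) (m_gt0 : (0 < m)%N) (card_k : #|k| = (p ^ m)%N).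
Variables (F : fieldType) (iota : {rmorphism k -> F}).
Hypothesis FF : function_field iota.
Variable (x : F).
Hypothesis tx : transcendental iota x.
Local Notation q := #|k|.
Local Notation ev := (eval_at iota).
Local Notation ae := (almost_everywhere iota x).

Let pF : p \in [pchar F] := pcharF p_prime card_k iota.

Let fB (u v : F) j : (u - v) ^+ (q ^ j) = u ^+ (q ^ j) - v ^+ (q ^ j).
Proof. exact (frobB p_prime card_k u v j pF). Qed.

Let fD (u v : F) j : (u + v) ^+ (q ^ j) = u ^+ (q ^ j) + v ^+ (q ^ j).
Proof. exact (frobD p_prime card_k u v j pF). Qed.

(** The element [z] becomes integral over k[x] once the leading coefficient of its relation is a
    unit. *)
Lemma ae_vring z : ae (fun O => O z).
Proof.
have [G G0 Gz] := alg_over_relation (alg_over_transcendental FF z tx).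
have lG : ev x (lead_coef G) != 0.
  by apply: transcendental_eval; rewrite ?lead_coef_eq0.
exists (lead_coef G); first by rewrite lead_coef_eq0.
move=> O VO Ox Ul; apply: (vring_integrally_closed VO) Gz => //.
  by move=> i; rewrite coef_map; apply: (vring_eval VO).
by rewrite lead_coef_map_eq.
Qed.

Lemma ae_vunit z : z != 0 -> ae (fun O => vunit O z).
Proof.
move=> z0; have := ae_and (ae_vring z) (ae_vring z^-1).
by apply: ae_impl => O _ _ [].
Qed.

(** The element is built in finitely many steps, each of which only needs certain elements to be
    regular or units, and so excludes finitely many places. *)
Lemma ae_etale z : sep_closure iota x z -> ae (fun O => etale_closure iota x O z).
Proof.
elim=> [a||u v _ Hu _ Hv|u v _ Hu _ Hv|u _ Hu|f b _ Hf fb dfb].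
- by apply: ae_all => O _ _; apply: EtConst.
- by apply: ae_all => O _ _; apply: EtVar.
- by have := ae_and Hu Hv; apply: ae_impl => O _ _ [? ?]; apply: EtB.
- by have := ae_and Hu Hv; apply: ae_impl => O _ _ [? ?]; apply: EtM.
- have [->|u0] := eqVneq u 0.
    by rewrite invr0 -(rmorph0 iota); apply: ae_all => O _ _; apply: EtConst.
  have := ae_and Hu (ae_vunit u0).
  by apply: ae_impl => O _ _ [? ?]; apply: EtV.
- have := ae_and (ae_forall (size f) Hf) (ae_and (ae_vring b) (ae_vunit dfb)).
  apply: ae_impl => O _ _ [Hf' [Ob Ub]]; apply: EtRoot fb Ub => // i.
  have [/Hf'//|le] := ltnP i (size f).
  by rewrite nth_default // -(rmorph0 iota); apply: EtConst.
Qed.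

(** * Divisibility by [H] at a fixed place *)

Section AtPlace.
Variable (O : set F).
Hypotheses (VO : valuation_ring iota [set: F] O) (Ox : O x).
Local Notation et := (etale_closure iota x O).

Let Fdiv (a b : F) : [set: F] a -> [set: F] b -> [set: F] (a / b).
Proof. by []. Qed.

(** Otherwise all nonzero polynomials in a transcendental [z] would be units of [O]; then every
    element of F, being algebraic over k(z), would be integral over [O], making [O] all of F. *)
Lemma residue_algebraic z : O z -> exists2 c, c != 0 & vmax O (ev z c).
Proof.
move=> Oz; have [tz|/(not_transcendental FF)[a ->]] :=
  pselect (transcendental iota z); last first.
  exists ('X - a%:P); first by rewrite polyXsubC_eq0.
  by rewrite rmorphB /= eval_atX eval_atC subrr; apply: (vmax0 VO).
apply: contrapT => nM; have [w _] := vring_proper VO; apply.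
have [G G0 Gw] := alg_over_relation (alg_over_transcendental FF w tz).
have lG : lead_coef G != 0 by rewrite lead_coef_eq0.
apply: (vring_integrally_closed VO) Gw => //.
  by move=> i; rewrite coef_map; apply: (vring_eval VO).
rewrite lead_coef_map_eq ?transcendental_eval //.
have [//|Ml] := vunit_or_vmax (vring_eval VO (lead_coef G) Oz).
by case: nM; exists (lead_coef G).
Qed.

Lemma residue_frob z : O z ->
  exists2 j, (0 < j)%N & forall i, vmax O (z ^+ (q ^ (j * i)) - z).
Proof.
move=> Oz; have [c c0 Mc] := residue_algebraic Oz.
exact: (vmax_frob p_prime card_k VO Fdiv Oz c0 Mc).
Qed.

Variable (h : {poly k}).
Hypotheses (size_h : (1 < size h)%N) (Mh : vmax O (ev x h))
  (min_h : forall c, vmax O (ev x c) -> h %| c).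
Local Notation H := (ev x h).

Lemma H_neq0 : H != 0.
Proof. by apply: transcendental_eval => //; rewrite -size_poly_gt0 ltnW. Qed.

Lemma dvd_H c : vmax O (ev x c) -> exists d, c = d * h /\ ev x c = H * ev x d.
Proof.
move=> /min_h/dvdpP[d ->]; exists d; split=> //.
by rewrite rmorphM mulrC.
Qed.

(** The polynomial ['X^(q ^ i) - 'X] has derivative -1, so [h] cannot divide it twice. *)
Lemma frob_x_uniformizer i : (0 < i)%N -> vmax O (x ^+ (q ^ i) - x) ->
  exists2 u, vunit O u & x ^+ (q ^ i) - x = H * u.
Proof.
move=> i0; have xE : x ^+ (q ^ i) - x = ev x ('X^(q ^ i) - 'X).
  by rewrite rmorphB rmorphXn /= eval_atX.
rewrite xE => /dvd_H[d [dE ->]]; exists (ev x d) => //.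
have [//|/dvd_H[e [eE _]]] := vunit_or_vmax (vring_eval VO d Ox).
have pk := card_finPcharP card_k p_prime.
have qi0 : (q ^ i)%:R = 0 :> {poly k}.
  apply/eqP; rewrite -(dvdn_pcharf (_ : p \in _)) ?pchar_poly // card_k -expnM.
  by rewrite dvdn_exp // muln_gt0 m_gt0.
have /(congr1 (@deriv _)) := dE; rewrite eE derivB derivXn derivX.
rewrite -mulr_natr qi0 mulr0 sub0r !derivM => E1.
have : h %| - 1.
  rewrite E1; apply: dvdp_add; first exact: dvdp_mull.
  by apply: dvdp_mulr; apply: dvdp_mull.
by rewrite dvdpNr dvdp1 => /eqP hs; move: size_h; rewrite hs.
Qed.

(* For [EtRoot], put [s = b^N - b]: modulo [H] the Frobenius fixes the
   coefficients of [f], so [H] divides [f.[b + s] = s * (f'.[b] + s * c)], whose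
   second factor is a unit because [s] vanishes at the place. *)
Lemma et_frob z : et z -> exists2 j, (0 < j)%N &
  forall i, exists2 w, et w & z ^+ (q ^ (j * i)) - z = H * w.
Proof.
have et0 : et 0 by rewrite -(rmorph0 iota); apply: EtConst.
have etD u v : et u -> et v -> et (u + v).
  by rewrite !etP; apply: rpredD.
have etX u n : et u -> et (u ^+ n) by rewrite !etP; apply: rpredX.
elim=> [a||u v eu [j j0 Hu] ev [l l0 Hv]|u v eu [j j0 Hu] ev [l l0 Hv]
       |u eu [j j0 Hu] Uu|f b ef Hf Ob fb Ub].
- by exists 1%N => // i; exists 0; rewrite // const_frob subrr mulr0.
- have [j j0 Mx] := residue_frob Ox; exists j => // i.
  have := Mx i; have -> : x ^+ (q ^ (j * i)) - x = ev x ('X^(q ^ (j * i)) - 'X).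
    by rewrite rmorphB rmorphXn /= eval_atX.
  by move=> /dvd_H[d [_ ->]]; exists (ev x d) => //; apply: et_eval.
(* The product is a multiple of both exponents, so both hypotheses apply with the same power. *)
- exists (j * l)%N => [|i]; first by rewrite muln_gt0 j0.
  have [w ew wE] := Hu (l * i)%N; have [w' ew' w'E] := Hv (j * i)%N.
  exists (w - w'); first exact: EtB.
  rewrite fB mulrBr -wE -w'E !mulnA (mulnC l j); ring.
- exists (j * l)%N => [|i]; first by rewrite muln_gt0 j0.
  have [w ew wE] := Hu (l * i)%N; have [w' ew' w'E] := Hv (j * i)%N.
  move: wE w'E; rewrite !mulnA (mulnC l j); set N := (q ^ _)%N => wE w'E.
  exists (w * v ^+ N + u * w').
    by apply: etD; apply: EtM => //; apply: etX.
  rewrite exprMn mulrDr mulrA -wE mulrCA -w'E; ring.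
- exists j => // i; have [w ew wE] := Hu i.
  move: wE; set N := (q ^ _)%N => wE.
  exists (- w * (u^-1 ^+ N * u^-1)).
    have euV := EtV eu Uu.
    apply: EtM; last by apply: EtM => //; apply: etX.
    by rewrite -sub0r; apply: EtB.
  rewrite mulrA mulrN -wE exprVn; case: Uu => u0 _ _; field.
  by rewrite u0 expf_neq0.
- have [J J0 HJ] : exists2 J, (0 < J)%N & forall i l, exists2 w, et w &
      f`_l ^+ (q ^ (J * i)) - f`_l = H * w.
    have /choice[jf jfP] (l : nat) : exists j, (0 < j)%N /\ forall i,
        exists2 w, et w & f`_l ^+ (q ^ (j * i)) - f`_l = H * w.
      by have [j j0 Hj] := Hf l; exists j.
    (* One exponent serves all coefficients; beyond [size f] they vanish. *)
    exists (\prod_(l < size f) jf l)%N.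
      by rewrite prodn_gt0 // => l; case: (jfP l).
    move=> i l; have [lt|le] := ltnP l (size f).
      rewrite (bigD1 (Ordinal lt)) //= -mulnA; case: (jfP l) => _; exact.
    exists 0 => //; rewrite nth_default // expr0n gtn_eqF ?subrr ?mulr0 //.
    by rewrite expn_gt0 ltnW ?q_gt1.
  have [l l0 Mb] := residue_frob Ob.
  have eb : et b by apply: EtRoot fb Ub.
  exists (J * l)%N => [|i]; first by rewrite muln_gt0 J0.
  move: (Mb (J * i)%N) (HJ (l * i)%N); rewrite !mulnA (mulnC l J).
  set N := (q ^ _)%N => {}Mb {}HJ.
  have N0 : (0 < N)%N by rewrite expn_gt0 ltnW ?q_gt1.
  (* Raising f(b) to the power [N] replaces each coefficient by its [N]-th power, which agrees with
     it modulo [H]. *)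
  have [w ew fN] : exists2 w, et w & f.[b ^+ N] - f.[b] ^+ N = H * w.
    have eN : et (b ^+ N) by apply: etX.
    elim/poly_ind: (f) HJ => [|g a IH] HJ'.
      by exists 0 => //; rewrite !horner0 expr0n gtn_eqF // subrr mulr0.
    have [|w ew gE] := IH.
      by move=> n; have := HJ' n.+1; rewrite coefD coefMX coefC addr0.
    have [w' ew' aE] := HJ' 0%N.
    rewrite coefD coefMX coefC /= add0r in aE.
    exists (w * b ^+ N - w'); first by apply: EtB => //; apply: EtM.
    by rewrite mulrBr mulrA -gE -aE !hornerE /N fD exprMn -/N; ring.
  pose s := b ^+ N - b; have es : et s by apply: EtB => //; apply: etX.
  have [i0|||c] := @poly_taylor2 _ (etpred iota x O) f b s; rewrite -?etP //.
  move=> ec; rewrite fb add0r /s addrC subrK => fbN.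
  have ed : et f^`().[b].
    rewrite etP; apply: rpred_horner; last by rewrite -etP.
    by apply/polyOver_deriv/polyOverP => n; rewrite -etP.
  have Usc : vunit O (f^`().[b] + s * c).
    apply: (vunitD VO) => //; apply: (vmaxMr VO) => //.
    exact: (et_vring VO Ox).
  exists (w * (f^`().[b] + s * c)^-1).
    by apply: EtM => //; apply: EtV => //; apply: etD => //; apply: EtM.
  rewrite mulrA -fN fb expr0n gtn_eqF // subr0 fbN -/s; case: Usc => Usc0 _ _.
  by field.
Qed.
(** In [z ^+ N - z = z * (z ^+ N.-1 - 1)] the last factor is a unit since [z] vanishes at the place,
    and the left side is divisible by [H]. *)
Lemma et_max_dvd z : et z -> vmax O z -> exists2 w, et w & z = H * w.
Proof.
move=> ez Mz; have [j j0 /(_ 1%N)[w ew]] := et_frob ez.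
have : (1 < q ^ (j * 1))%N by rewrite muln1 -(expn0 q) ltn_exp2l // q_gt1.
move: (q ^ _)%N => [|[|N]] // _ zE.
have U : vunit O (z ^+ N.+1 - 1).
  rewrite addrC; apply: (vunitD VO) => //.
    rewrite -(rmorph1 iota) -rmorphN; apply: (vunit_const VO).
    by rewrite oppr_eq0 oner_neq0.
  by rewrite exprS; apply: (vmaxMr VO) => //; apply: (vringX VO); case: Mz.
exists (w * (z ^+ N.+1 - 1)^-1).
  apply: EtM => //; apply: EtV => //; rewrite etP rpredB ?rpred1 //.
  by rewrite rpredX // -etP.
rewrite mulrA -zE; case: U => U0 _ _.
by rewrite exprS -[X in _ - X]mulr1 -mulrBr mulfK.
Qed.

(** Each factor [H] of c(x) comes from a factor [h] of the polynomial [c], which costs at least one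
    degree. *)
Lemma order_bound n c w : c != 0 -> O w -> ev x c = H ^+ n * w ->
  (n < size c)%N.
Proof.
move=> + Ow; elim: n c => [|n IH] c c0 cE; first by rewrite size_poly_gt0.
have /dvd_H[d [dE]] : vmax O (ev x c).
  rewrite cE exprS -mulrA; apply: (vmaxMr VO) => //.
  by apply: (vringM VO) => //; apply: (vringX VO); case: Mh.
rewrite cE exprS -mulrA => /(mulfI H_neq0) /esym/IH lt_n.
have d0 : d != 0 by apply: contraNneq c0 => d0; rewrite dE d0 mul0r.
have h0 : h != 0 by rewrite -size_poly_gt0 ltnW.
rewrite dE size_mul // -(ltn_predK size_h) addnS /=.
rewrite (leq_ltn_trans (lt_n d0)) // -[X in (X < _)%N]addn0 ltn_add2l.
by rewrite -ltnS (ltn_predK size_h).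
Qed.

(** In an algebraic relation for [z], powers of the variable are stripped until the constant term is
    nonzero; that term is then a multiple of [z]. *)
Lemma dvd_eval z : z != 0 -> O z ->
  exists c w, [/\ c != 0, O w & ev x c = z * w].
Proof.
move=> z0 Oz.
have [G] := alg_over_relation (alg_over_transcendental FF z tx).
elim/poly_ind: G => [|G a IH]; first by rewrite eqxx.
move=> Ga0; rewrite rmorphD rmorphM /= map_polyX map_polyC !hornerE /=.
have [a0|a0] := eqVneq a 0; last first.
  move/eqP; rewrite addrC addr_eq0 => /eqP aE.
  exists a, (- (map_poly (ev x) G).[z]); split=> //.
    apply: (vringN VO); have /(vpredP VO) Oz' := Oz.
    apply/(vpredP VO)/rpred_horner => //; apply/polyOverP => i.
    by rewrite coef_map; apply/(vpredP VO)/(vring_eval VO).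
  by rewrite mulrN mulrC.
rewrite a0 rmorph0 addr0 => /eqP; rewrite mulf_eq0 (negPf z0) orbF => /eqP.
by apply: IH; apply: contraNneq Ga0 => ->; rewrite a0 mul0r addr0.
Qed.

Lemma et_factor z : et z -> z != 0 ->
  exists n u, vunit O u /\ z = H ^+ n * u.
Proof.
move=> ez z0; have [c [w [c0 Ow cE]]] := dvd_eval z0 (et_vring VO Ox ez).
(* The size of [c] bounds the number of factors [H] of [z]; it is the fuel of the induction that
   extracts them. *)
have : forall w', O w' -> z <> H ^+ size c * w'.
  move=> w' Ow' zE; suff : (size c < size c)%N by rewrite ltnn.
  by apply: (order_bound c0 (vringM VO Ow' Ow)); rewrite cE zE mulrA.
elim: (size c) z ez z0 {cE} => [|n IH] z ez z0 nz.
  by case: (nz z); rewrite ?expr0 ?mul1r //; apply: (et_vring VO Ox).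
have [Uz|Mz] := vunit_or_vmax (et_vring VO Ox ez).
  by exists 0%N, z; rewrite expr0 mul1r.
have [z' ez' zE] := et_max_dvd ez Mz.
have z'0 : z' != 0 by apply: contraNneq z0 => z'0; rewrite zE z'0 mulr0.
have [|i [u [Uu z'E]]] := IH z' ez' z'0.
  by move=> w' Ow' z'E; apply: (nz w') => //; rewrite zE z'E mulrA exprS.
by exists i.+1, u; rewrite zE z'E mulrA exprS.
Qed.

Hypothesis et_frac : forall z, exists a b, [/\ et a, et b, b != 0 & z = a / b].

(** As a fraction, [t] is a power of [H], possibly with negative exponent, times a unit. An exponent
    at most 0 makes [t] a unit; a positive one gives t = H s, and 1 = H s^2 w makes [H] a unit. *)
Lemma H_unramified t w : vmax O t -> O w -> H <> t ^+ 2 * w.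
Proof.
move=> Mt Ow HE; have t0 : t != 0.
  by apply: contra_eq_neq HE => ->; rewrite expr0n mul0r H_neq0.
have [a [b [ea eb b0 tE]]] := et_frac t.
have a0 : a != 0 by apply: contraNneq t0 => a0; rewrite tE a0 mul0r.
have [i [u [Uu aE]]] := et_factor ea a0.
have [j [v [Uv bE]]] := et_factor eb b0.
have OH : O H by case: Mh.
have [[u0 Ou OuV] [v0 Ov OvV]] := (Uu, Uv).
have [le_ij|lt_ji] := leqP i j.
  apply: (vmax_nunit Mt); split=> //; first exact: vmaxW Mt.
  rewrite tE aE bE -(subnK le_ij) exprD.
  rewrite (_ : _^-1 = H ^+ (j - i) * (v * u^-1)).
    by apply: (vringM VO); [apply: (vringX VO)|apply: (vringM VO)].
  by field; rewrite v0 u0 !expf_neq0 // H_neq0.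
have tH : t = H * (H ^+ (i - j.+1) * (u * v^-1)).
  rewrite tE aE bE -{1}(subnK lt_ji) exprD exprS.
  by field; rewrite v0 expf_neq0 // H_neq0.
apply: (vmax_nunit Mh); move: tH; set s := _ * (u * _) => tH.
have Os : O s by apply: (vringM VO); [apply: (vringX VO)|apply: (vringM VO)].
apply: (vunitMl VO OH (b := s ^+ 2 * w)).
  by apply: (vringM VO) => //; apply: (vringX VO).
rewrite (_ : H * _ = 1); first exact: (vunit1 VO).
by apply: (mulfI H_neq0); rewrite mulr1 [RHS]HE tH; ring.
Qed.

End AtPlace.

(** It suffices that the finitely many field generators of F lie in the closure. *)
Lemma ae_fractions : (forall z, sep_closure iota x z) ->
  ae (fun O => forall z, exists a b, [/\ etale_closure iota x O a,
    etale_closure iota x O b, b != 0 & z = a / b]).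
Proof.
move=> sep; have [[x0 [_ [n [b bP]]]] _] := FF.
(* Padding by 0 extends the family to [nat], the index type of [ae_forall]. *)
pose b' i := if insub i is Some j then b j else 0.
have := ae_and (ae_etale (sep x0)) (ae_forall n (fun i => ae_etale (sep (b' i)))).
apply: ae_impl => O VO Ox [ex0 eb].
have e1 : etale_closure iota x O 1 by rewrite -(rmorph1 iota); apply: EtConst.
have eW z : etale_closure iota x O z -> exists a b, [/\ etale_closure iota x O a,
    etale_closure iota x O b, b != 0 & z = a / b].
  by exists z, 1; rewrite divr1 oner_neq0.
apply: (generated_ind bP) => [a||i|u v|u v|u].
- exact/eW/EtConst.
- exact: eW.
- by apply: eW; have := eb i (ltn_ord i); rewrite /b' valK.
- move=> [a [c [ea ec c0 ->]]] [a' [c' [ea' ec' c'0 ->]]].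
  exists (a * c' - a' * c), (c * c').
  split; [by apply: EtB; apply: EtM|exact: EtM|exact: mulf_neq0|].
  by field; rewrite c0 c'0.
- move=> [a [c [ea ec c0 ->]]] [a' [c' [ea' ec' c'0 ->]]].
  exists (a * a'), (c * c'); split; [exact: EtM|exact: EtM|exact: mulf_neq0|].
  by field; rewrite c0 c'0.
- move=> [a [c [ea ec c0 ->]]].
  have [->|a0] := eqVneq a 0; last by exists c, a; rewrite invf_div.
  rewrite mul0r invr0; apply: eW; rewrite -(rmorph0 iota); exact: EtConst.
Qed.

End FunctionField.

(** * Places of k(y) *)

Section PlaceAtInfinity.
Variables (k F : fieldType) (iota : {rmorphism k -> F}) (E O : set F).
Hypothesis VO : valuation_ring iota E O.
Hypothesis Ediv : forall a b, E a -> E b -> E (a / b).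
Implicit Types (z : F).
Local Notation ev := (eval_at iota).

Lemma vring_expI z n : E z -> (0 < n)%N -> O (z ^+ n) -> O z.
Proof.
move=> Ez; case: n => // n _ Ozn; apply: contrapT => nOz.
have OV := vmaxW (vmaxV VO Ez nOz).
have z0 : z != 0 by apply: contra_notN nOz => /eqP->; exact: (vring0 VO).
apply: nOz; rewrite (_ : z = z^-1 ^+ n * z ^+ n.+1).
  by apply: (vringM VO) => //; apply: (vringX VO).
by rewrite exprSr mulrA -exprMn mulVf // expr1n mul1r.
Qed.

(** At a pole of [y] the leading term dominates. *)
Lemma infinite_eval y c : E y -> ~ O y -> c != 0 ->
  exists2 u, vunit O u & ev y c = y ^+ (size c).-1 * u.
Proof.
move=> Ey nOy; have MV := vmaxV VO Ey nOy.
have y0 : y != 0 by apply: contra_notN nOy => /eqP->; exact: (vring0 VO).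
elim/poly_ind: c => [|c a IH]; first by rewrite eqxx.
have [->|c0 _] := eqVneq c 0.
  rewrite mul0r add0r polyC_eq0 => a0; exists (iota a).
    exact: (vunit_const VO).
  by rewrite eval_atC size_polyC a0 mul1r.
have [u Uu cE] := IH c0.
exists (u + iota a * y^-1 ^+ size c).
  apply: (vunitD VO) => //; apply: (vmaxMl VO); first exact: (vring_const VO).
  rewrite -(prednK (_ : 0 < size c)%N) ?size_poly_gt0 // exprS.
  by apply: (vmaxMr VO) => //; apply: (vringX VO); apply: vmaxW.
rewrite size_MXaddC (negPf c0) /= rmorphD rmorphM /= eval_atX eval_atC cE.
rewrite mulrDr; congr (_ + _); last first.
  by rewrite mulrCA -exprMn mulfV // expr1n mulr1.
by rewrite mulrAC -exprSr prednK ?size_poly_gt0.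
Qed.

(** Degrees decide membership in [O], which makes the pole of [y] in k(y) unique, and [y^-1] divides
    every nonunit, which makes it a prime element there. *)
Lemma infinite_ratio y a b : E y -> ~ O y -> a != 0 -> b != 0 ->
  (O (ev y a / ev y b) <-> (size a <= size b)%N) /\
  (vmax O (ev y a / ev y b) ->
    exists2 w, O w & ev y a / ev y b = y^-1 * w).
Proof.
move=> Ey nOy a0 b0; have MV := vmaxV VO Ey nOy; have OV := vmaxW MV.
have y0 : y != 0 by apply: contra_notN nOy => /eqP->; exact: (vring0 VO).
have [u Uu aE] := infinite_eval Ey nOy a0.
have [v Uv bE] := infinite_eval Ey nOy b0.
have [[u0 _ _] [v0 _ _]] := (Uu, Uv).
have Uuv : vunit O (u / v) by apply: (vunitM VO) => //; apply: (vunitV).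
have [_ Ouv _] := Uuv.
rewrite aE bE; have [le_ab|lt_ba] := leqP (size a) (size b).
  have le' : ((size a).-1 <= (size b).-1)%N by rewrite -!subn1 leq_sub2r.
  set z := _ / _; have zE : z = y^-1 ^+ ((size b).-1 - (size a).-1) * (u / v).
    rewrite /z -{1}(subnK le') exprD exprVn.
    by field; rewrite !expf_neq0 // v0.
  split=> [|Mz].
    by split=> // _; rewrite zE; apply: (vringM VO) => //; apply: (vringX VO).
  case Dd: ((size b).-1 - (size a).-1)%N zE => [|d] zE.
    by case: (vmax_nunit Mz); rewrite zE mul1r.
  exists (y^-1 ^+ d * (u / v)); last by rewrite zE exprS mulrA.
  by apply: (vringM VO) => //; apply: (vringX VO).
have lt' : ((size b).-1 < (size a).-1)%N.
  by rewrite -!subn1 ltn_sub2r // (leq_trans _ lt_ba) // ltnS size_poly_gt0.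
set z := _ / _; have zE : z^-1 = y^-1 ^+ ((size a).-1 - (size b).-1) * (v / u).
  rewrite /z -{1}(subnK (ltnW lt')) exprD exprVn.
  by field; rewrite !expf_neq0 // v0 u0.
have MzV : vmax O z^-1.
  rewrite zE; apply: (vmaxMr VO).
    by apply: (vringM VO); [case: Uv|case: Uu].
  rewrite -subn_gt0 in lt'; rewrite -(prednK lt') exprS.
  by apply: (vmaxMr VO) => //; apply: (vringX VO).
have nOz : ~ O z.
  move=> Oz; apply: (vmax_nunit MzV); split; rewrite ?invrK //.
    by rewrite invr_eq0 !mulf_neq0 ?invr_eq0 ?mulf_neq0 ?expf_neq0.
  exact: vmaxW MzV.
by split=> [|/vmaxW//]; split.
Qed.

End PlaceAtInfinity.

Section Places.
Variables (k F : fieldType) (iota : {rmorphism k -> F}) (E : set F).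
Local Notation ev := (eval_at iota).

Lemma place_unitE (P : place iota E) u :
  place_unit P u <-> vunit (place_ring P) u.
Proof.
split=> [[Ou [w Ow uw1]]|[u0 Ou OV]]; last first.
  by split=> //; exists u^-1; rewrite ?mulfV.
have u0 : u != 0.
  by apply: contra_eq_neq uw1 => ->; rewrite mul0r eq_sym oner_neq0.
by split=> //; rewrite -[u^-1]mulr1 -uw1 mulKf.
Qed.

Lemma place_idealE (P : place iota E) z :
  place_ideal P z <-> vmax (place_ring P) z.
Proof. by split=> -[Oz nU]; split=> //; rewrite ?place_unitE // -place_unitE. Qed.

Lemma prime_elementP (P : place iota E) t : vmax (place_ring P) t ->
  (forall z, vmax (place_ring P) z ->
    exists2 w, place_ring P w & z = t * w) -> prime_element P t.
Proof.
move=> Mt dvd_t; apply/seteqP; split=> z.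
  by rewrite place_idealE => /dvd_t[w Ow ->]; exists w.
by move=> [w Ow <-]; rewrite place_idealE; apply: (vmaxMr (place_ringP P)).
Qed.

Lemma prime_element_max (P : place iota E) t :
  prime_element P t -> vmax (place_ring P) t.
Proof.
move=> tP; rewrite -place_idealE tP; exists 1; rewrite ?mulr1 //.
exact: (vring1 (place_ringP P)).
Qed.

Lemma place_inj (P Q : place iota E) : place_ring P = place_ring Q -> P = Q.
Proof.
case: P Q => [O VO] [O' VO'] /= OO'; rewrite -OO' in VO' *.
by rewrite (Prop_irrelevance VO VO').
Qed.

End Places.

Section RationalPlaces.
Variables (k F : fieldType) (iota : {rmorphism k -> F}) (y : F).
Local Notation E := (rational_subfield iota y).
Local Notation ev := (eval_at iota).

Lemma rational_subfield_div a b : E a -> E b -> E (a / b).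
Proof.
move=> Ea Eb; apply/asboolP; have [_ _] := ratpred_divring iota y.
by apply; apply/asboolP.
Qed.

Lemma rational_subfield_var : E y.
Proof. by rewrite -{2}(eval_atX iota y); apply: rational_subfield_eval. Qed.

Lemma infinite_place_unique (Q1 Q2 : place iota E) :
  ~ place_ring Q1 y -> ~ place_ring Q2 y -> Q1 = Q2.
Proof.
move=> n1 n2; apply: place_inj; apply/seteqP.
suff H (P1 P2 : place iota E) : ~ place_ring P1 y -> ~ place_ring P2 y ->
    place_ring P1 `<=` place_ring P2 by split; apply: H.
move=> {}n1 {}n2 z Oz; have := vring_sub (place_ringP P1) Oz.
move=> /rational_subfieldP[a [b [b0 zE]]].
have [a0|a0] := eqVneq a 0.
  by rewrite zE a0 rmorph0 mul0r; apply: (vring0 (place_ringP P2)).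
have b0' : b != 0 by apply: contraNneq b0 => ->; rewrite rmorph0.
have Ey := rational_subfield_var; have Ediv := rational_subfield_div.
have [H2 _] := infinite_ratio (place_ringP P2) Ediv Ey n2 a0 b0'.
have [H1 _] := infinite_ratio (place_ringP P1) Ediv Ey n1 a0 b0'.
by rewrite zE; apply/H2/H1; rewrite -zE.
Qed.

Lemma infinite_place_pole (Q : place iota E) : ~ place_ring Q y -> is_pole Q y.
Proof.
move=> nOy; exists (-1) => //; exists y^-1, 1; split.
- have VQ := place_ringP Q; have Ediv := rational_subfield_div.
  have Ey := rational_subfield_var.
  apply: prime_elementP; first exact: (vmaxV VQ).
  move=> z Mz; have := vring_sub VQ (vmaxW Mz).
  move=> /rational_subfieldP[a [b [b0 zE]]].
  have [a0|a0] := eqVneq a 0.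
    exists 0; first exact: (vring0 VQ).
    by rewrite zE a0 rmorph0 mul0r mulr0.
  have b0' : b != 0 by apply: contraNneq b0 => ->; rewrite rmorph0.
  by rewrite zE; apply: (infinite_ratio VQ Ediv Ey nOy a0 b0').2; rewrite -zE.
- by rewrite place_unitE; apply: (vunit1 (place_ringP Q)).
- by rewrite mulr1 exprN1 invrK.
Qed.

(** Here [g] is the minimal polynomial of the residue of [y]. In a reduced fraction from the maximal
    ideal, [g] divides the numerator, hence not the denominator, which is therefore a unit. *)
Lemma finite_place (Q : place iota E) : place_ring Q y ->
  exists2 g : {poly k}, (1 < size g)%N & [/\ vmax (place_ring Q) (ev y g),
    prime_element Q (ev y g) &
    forall c, vmax (place_ring Q) (ev y c) -> g %| c].
Proof.
move=> Oy; have VQ := place_ringP Q; have Ediv := rational_subfield_div.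
have [c c0 Mc] : exists2 c, c != 0 & vmax (place_ring Q) (ev y c).
  (* If no nonzero polynomial in [y] vanished at [Q], all would be units and the ring would be all
     of k(y). *)
  apply: contrapT => nM; have [z Ez] := vring_proper VQ; apply.
  have /rational_subfieldP[a [b [b0 ->]]] := Ez.
  apply: (vringM VQ); first exact: (vring_eval VQ).
  have [[]//|Mb] := vunit_or_vmax (vring_eval VQ b Oy).
  by case: nM; exists b => //; apply: contraNneq b0 => ->; rewrite rmorph0.
have [g [sg Mg min_g]] := vmax_min_poly VQ Ediv Oy (ex_intro2 _ _ c c0 Mc).
exists g => //; split=> //; apply: prime_elementP => // z Mz.
have /rational_subfieldP[a [b [b0 zE]]] := vring_sub VQ (vmaxW Mz).
have b0' : b != 0 by apply: contraNneq b0 => ->; rewrite rmorph0.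
have cop := coprimep_div_gcd (_ : (a != 0) || (b != 0)).
have {cop} : coprimep (a %/ gcdp a b) (b %/ gcdp a b) by rewrite cop // b0' orbT.
have [aE bE] := (divpK (dvdp_gcdl a b), divpK (dvdp_gcdr a b)).
move: aE bE; set a' := a %/ _; set b' := b %/ _; set d := gcdp a b.
move=> aE bE cop; rewrite -bE rmorphM /= mulf_eq0 negb_or in b0.
have /andP[b'0 d0] := b0.
have {}zE : z = ev y a' / ev y b'.
  by rewrite zE -aE -bE !rmorphM /= -mulf_div mulfV // mulr1.
have Oa := vring_eval VQ a' Oy; have Ob := vring_eval VQ b' Oy.
have zb : z * ev y b' = ev y a' by rewrite zE divfK.
have /min_g/dvdpP[e eE] : vmax (place_ring Q) (ev y a').
  by rewrite -zb; apply: (vmaxMr VQ).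
have [[_ _ ObV]|/min_g gb] := vunit_or_vmax Ob.
  exists (ev y e / ev y b').
    by apply: (vringM VQ) => //; apply: (vring_eval VQ).
  by rewrite zE eE rmorphM mulrA (mulrC (ev y g)).
have : g %| gcdp a' b' by rewrite dvdp_gcd gb eE dvdp_mull.
move: cop; rewrite -gcdp_eqp1 => /eqp_dvdr->; rewrite dvdp1 => /eqP sg1.
by move: sg; rewrite sg1.
Qed.

End RationalPlaces.

(** * The covering *)

Section Cover.
Variables (p m : nat) (k : finFieldType).
Hypotheses (p_prime : prime p) (m_gt0 : (0 < m)%N) (card_k : #|k| = (p ^ m)%N).
Variables (F : fieldType) (iota : {rmorphism k -> F}).
Hypothesis FF : function_field iota.
Variable (x : F).
Hypothesis tx : transcendental iota x.
Local Notation q := #|k|.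
Local Notation ev := (eval_at iota).
Local Notation ae := (almost_everywhere iota x).

Let pF : p \in [pchar F] := pcharF p_prime card_k iota.

Let fB (u v : F) j : (u - v) ^+ (q ^ j) = u ^+ (q ^ j) - v ^+ (q ^ j).
Proof. exact (frobB p_prime card_k u v j pF). Qed.

Let fD (u v : F) j : (u + v) ^+ (q ^ j) = u ^+ (q ^ j) + v ^+ (q ^ j).
Proof. exact (frobD p_prime card_k u v j pF). Qed.

Let fpD (u v : F) : (u + v) ^+ p = u ^+ p + v ^+ p.
Proof. by apply: exprDn_pchar; rewrite pnatE. Qed.

Let Fdiv (a b : F) : [set: F] a -> [set: F] b -> [set: F] (a / b).
Proof. by []. Qed.

(** The element [y] of the construction, with M = q^l. The exponent [p] makes the first summand
    additive in S, so an increment D contributes only D^p, which is divisible by D^2. *)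
Definition cover (l : nat) : F :=
  (x ^+ (q ^ l) - x) ^+ p + (x ^+ (q ^ l) - x)^-1.

Lemma q_exp_gt1 l : (0 < l)%N -> (1 < q ^ l)%N.
Proof. by move=> l0; rewrite -(expn0 q) ltn_exp2l // q_gt1. Qed.

Lemma frob_poly_neq0 l : (0 < l)%N -> 'X^(q ^ l) - 'X != 0 :> {poly k}.
Proof.
move=> l0; rewrite -size_poly_gt0 size_polyDl ?size_polyXn //.
by rewrite size_polyN size_polyX ltnS q_exp_gt1.
Qed.

Lemma frob_x_neq0 l : (0 < l)%N -> x ^+ (q ^ l) - x != 0.
Proof.
move=> l0; have := transcendental_eval tx (frob_poly_neq0 l0).
by rewrite rmorphB rmorphXn /= eval_atX.
Qed.

(* Where [cover l] is regular, [x^(q^l) - x] is a unit, hence so is every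
   polynomial in [x] dividing one of its powers. *)
Lemma cover_regular (P : set F -> Prop) : ae P -> exists2 l, (0 < l)%N &
  forall O, valuation_ring iota [set: F] O -> O (cover l) ->
    [/\ O x, vunit O (x ^+ (q ^ l) - x) & P O].
Proof.
move=> [d d0 dP]; have [l [r [l0 /dvdpP[e eE]]]] :=
  dvdp_frobenius p_prime card_k d0.
exists l => // O VO; rewrite /cover; set S := _ - x => OC.
have S0 : S != 0 by apply: frob_x_neq0.
have OS : O S.
  (* At a pole of [S] the term 1/S is regular, so S^p would be regular as well. *)
  apply: contrapT => nOS; have OV := vmaxW (vmaxV VO I nOS); apply: nOS.
  apply: (vring_expI VO (n := p)) => //; first exact: prime_gt0.
  by rewrite -(addrK S^-1 (S ^+ p)); apply: (vringB VO).
have US : vunit O S.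
  split=> //; rewrite -(addKr (S ^+ p) S^-1) addrC.
  by apply: (vringB VO) => //; apply: (vringX VO).
have Ox : O x.
  (* At a pole of [x] the element [S] is a power of [x] times a unit, so it could not be regular. *)
  apply: contrapT => nOx; have Mx := vmaxV VO I nOx; apply: nOx.
  have x0 : x != 0.
    by apply/eqP => xx0; move/eqP: S0; apply; rewrite /S xx0 expr0n gtn_eqF
      ?subrr // ltnW ?q_exp_gt1.
  have := q_exp_gt1 l0; rewrite /S in OS; move: (q ^ l)%N OS => [|[|N]] // OS _.
  apply: (vring_expI VO (n := N.+2)) => //.
  have [U0 OU OUV] : vunit O (1 - x^-1 ^+ N.+1).
    apply: (vunitD VO) => //; first exact: (vunit1 VO).
    apply: (vmaxN VO); rewrite exprS; apply: (vmaxMr VO) => //.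
    by apply: (vringX VO); apply: vmaxW Mx.
  have E1 : x ^+ N.+2 - x = x ^+ N.+2 * (1 - x^-1 ^+ N.+1).
    by rewrite mulrBr mulr1 exprVn exprS mulfK ?expf_neq0.
  by rewrite -(mulfK U0 (x ^+ N.+2)) -E1; apply: (vringM VO).
split=> //; apply: dP => //.
have [Od Oe] := (vring_eval VO d Ox, vring_eval VO e Ox).
apply: (vunitMl VO Od Oe); rewrite mulrC -rmorphM /= -eE.
by rewrite rmorphXn rmorphB rmorphXn /= eval_atX; apply: (vunitX VO).
Qed.

(** A value algebraic over k is a constant [a]; clearing the denominator gives s^(p+1) - a s + 1 = 0
    at [x], and this polynomial is nonzero because the nonconstant [s] does not divide 1. *)
Lemma cover_transcendental l : (0 < l)%N -> transcendental iota (cover l).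
Proof.
move=> l0 /(FF.2)[a]; rewrite /cover; set S := _ - x => SE.
have S0 : S != 0 by apply: frob_x_neq0.
have evS : ev x ('X^(q ^ l) - 'X) = S.
  by rewrite rmorphB rmorphXn /= eval_atX.
pose s : {poly k} := 'X^(q ^ l) - 'X.
have : ev x (s ^+ p.+1 - a *: s + 1) = 0.
  rewrite rmorphD rmorphB rmorph1 rmorphXn -mul_polyC rmorphM /= eval_atC evS.
  by rewrite -SE exprSr; field.
apply/eqP/transcendental_eval => //.
have ss : (1 < size s)%N.
  by rewrite size_polyDl ?size_polyXn ?size_polyN ?size_polyX ltnS ?q_exp_gt1 //
    ltnW // q_exp_gt1.
have s0 := frob_poly_neq0 l0.
apply/eqP => E0; have : s %| 1.
  rewrite -(dvdp_addr (m := s ^+ p.+1 - a *: s)) ?E0 ?dvdp0 //.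
  rewrite -mul_polyC exprS; apply: dvdp_sub; [exact: dvdp_mulr|exact: dvdp_mull].
by rewrite dvdp1 => /eqP s1; move: ss; rewrite s1.
Qed.

Section AtPlace.
Variable (O : set F).
Hypotheses (VO : valuation_ring iota [set: F] O) (Ox : O x).
Hypothesis frac : forall z, exists a b, [/\ etale_closure iota x O a,
    etale_closure iota x O b, b != 0 & z = a / b].

Lemma frob_x_unramified i t w : (0 < i)%N -> vmax O (x ^+ (q ^ i) - x) ->
  vmax O t -> O w -> x ^+ (q ^ i) - x <> t ^+ 2 * w.
Proof.
move=> i0 MT Mt Ow; have [c c0 Mc] := residue_algebraic FF VO Ox.
have [h [sh Mh min_h]] := vmax_min_poly VO Fdiv Ox (ex_intro2 _ _ c c0 Mc).
have [u [u0 Ou OuV] ->] :=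
  frob_x_uniformizer p_prime m_gt0 card_k VO Ox sh min_h i0 MT.
move=> HE; have := H_unramified p_prime card_k FF tx VO Ox sh Mh min_h frac Mt
  (vringM VO Ow OuV); apply.
by apply: (mulIf u0); rewrite HE; field.
Qed.

(* With [S = x^M - x], [T = x^N - x] and [D = T^M - T], one has
   [y^N - y = D (D^(p-1) - 1 / (S S^N))] for [y = S^p + 1/S], and the second
   factor is a unit; so a double zero of [y^N - y] would be one of [T]. *)
Lemma cover_unramified l J g t w : (0 < l)%N -> (0 < J)%N ->
  vunit O (x ^+ (q ^ l) - x) ->
  (forall i, g %| 'X^(q ^ (J * i)) - 'X) ->
  vmax O t -> O w -> ev (cover l) g <> t ^+ 2 * w.
Proof.
move=> l0 J0; set S := _ - x => US gJ Mt Ow gE.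
(* With N = q^(J n), the power N fixes the residue of [x], while [g] still divides X^N - X. *)
have [n n0 Mx] := residue_frob p_prime card_k FF VO Ox.
set y := cover l; have Oy : O y.
  case: US => S0 OS OSV; apply: (vringD VO) => //; exact: (vringX VO).
have i0 : (0 < J * n)%N by rewrite muln_gt0 J0.
have MT : vmax O (x ^+ (q ^ (J * n)) - x) by rewrite mulnC.
have /dvdpP[e eE] := gJ n.
have yE : y ^+ (q ^ (J * n)) - y = t ^+ 2 * (w * ev y e).
  rewrite (_ : _ - y = ev y ('X^(q ^ (J * n)) - 'X)).
    by rewrite eE rmorphM /= gE mulrC mulrA.
  by rewrite rmorphB rmorphXn /= eval_atX.
have Ow' : O (w * ev y e) by apply: (vringM VO) => //; apply: (vring_eval VO).
move: (w * _) Ow' yE => {gE Ow}w Ow yE.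
pose T := x ^+ (q ^ (J * n)) - x; pose D := T ^+ (q ^ l) - T.
have [S0 OS OSV] := US.
(* The two Frobenius powers commute, so S^N - S = T^M - T. *)
have SN : S ^+ (q ^ (J * n)) = S + D.
  rewrite /D /T /S !fB -!exprM mulnC; ring.
have USN : vunit O (S + D) by rewrite -SN; apply: (vunitX VO).
have [SN0 _ OSNV] := USN.
have yD : y ^+ (q ^ (J * n)) - y = D * (D ^+ p.-1 - (S * (S + D))^-1).
  rewrite /y /cover -/S fD exprVn exprAC SN fpD.
  rewrite -(prednK (prime_gt0 p_prime)) [D ^+ _.+1]exprS /=.
  by field; rewrite S0 SN0.
have OT := vmaxW MT.
have UM : vunit O (T ^+ (q ^ l).-1 - 1).
  rewrite addrC; apply: (vunitD VO) => //.
    rewrite -(rmorph1 iota) -rmorphN; apply: (vunit_const VO).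
    by rewrite oppr_eq0 oner_neq0.
  have := q_exp_gt1 l0; case: (q ^ l)%N => [|[|M]] // _ /=.
  by rewrite exprS; apply: (vmaxMr VO) => //; apply: (vringX VO).
have DE : D = T * (T ^+ (q ^ l).-1 - 1).
  by rewrite mulrBr mulr1 -exprS prednK // ltnW // q_exp_gt1.
have MD : vmax O D by rewrite DE; apply: (vmaxMr VO) => //; case: UM.
have UD : vunit O (D ^+ p.-1 - (S * (S + D))^-1).
  rewrite addrC; apply: (vunitD VO) => //.
    rewrite -mulN1r; apply: (vunitM VO).
      rewrite -(rmorph1 iota) -rmorphN; apply: (vunit_const VO).
      by rewrite oppr_eq0 oner_neq0.
    by apply: vunitV; apply: (vunitM VO).
  have := prime_gt1 p_prime; case: (p) => [|[|p']] // _ /=.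
  by rewrite exprS; apply: (vmaxMr VO) => //; apply: (vringX VO); apply: vmaxW.
case: UM UD => UM0 _ UMV [UD0 _ UDV].
apply: (frob_x_unramified i0 MT Mt (w := w *
    ((T ^+ (q ^ l).-1 - 1)^-1 * (D ^+ p.-1 - (S * (S + D))^-1)^-1))).
  by apply: (vringM VO) => //; apply: (vringM VO).
rewrite mulrA -yE yD; move: UD0; set Y := D ^+ p.-1 - _ => UD0.
by rewrite DE -/T; field; rewrite UD0 UM0.
Qed.

End AtPlace.

End Cover.

(** * Ramification in F/k(y) *)

Theorem theorem2p1 (p m q : nat) (p_prime : prime p) (m_gt0 : (0 < m)%N)
    (q_def : q = (p ^ m)%N) (k : finFieldType) (card_k : #|k| = q)
    (F : fieldType) (iota : {rmorphism k -> F}) (FF : function_field iota) :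
  exists y : F, transcendental iota y /\
    (forall Q1 Q2 : place iota (rational_subfield iota y),
       ramified Q1 -> ramified Q2 -> Q1 = Q2) /\
    (forall Q : place iota (rational_subfield iota y),
       ramified Q -> is_pole Q y).
Proof.
rewrite q_def in card_k.
have [x tx sepx] := separating_element p_prime m_gt0 card_k FF.
have [l l0 Hl] := cover_regular p_prime card_k tx (ae_fractions FF tx sepx).
pose y := cover p k x l; have ty : transcendental iota y.
  exact: (cover_transcendental FF tx l0).
have infinite (Q : place iota (rational_subfield iota y)) :
    ramified Q -> ~ place_ring Q y.
  move=> [P [e [_ He e1]]] Oy.
  have [g sg [Mg prime_g min_g]] := finite_place Oy.
  have g0 : g != 0 by rewrite -size_poly_gt0 ltnW.
  have VQ := place_ringP Q; have VP := place_ringP P.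
  have Ediv := @rational_subfield_div _ _ iota y.
  (* The prime element g(y) of [Q] has valuation 1, so in F it equals [t ^+ e] times a unit. *)
  have [|t [u [/prime_element_max Mt /place_unitE Uu]]] :=
      He (eval_at iota y g) 1 (vring_sub VQ (vmaxW Mg)) (transcendental_eval ty g0).
    exists (eval_at iota y g), 1; split=> //; last by rewrite mulr1.
    by rewrite place_unitE; apply: (vunit1 VQ).
  rewrite mulr1 -exprnP => gE.
  have [_ Ou _] := Uu.
  have Ot := vmaxW Mt.
  (* At a pole of [y], g(y) would be a positive power of [y] times a unit, whereas [t ^+ e * u] is
     regular at [P]. *)
  have OPy : place_ring P y.
    apply: contrapT => nOy.
    have [|u' [u'0 Ou' Ou'V] gE'] := infinite_eval VP _ I nOy g0; first by [].
    apply: nOy; apply: (vring_expI VP (n := (size g).-1)) => //.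
      by rewrite -ltnS (ltn_predK sg).
    rewrite -(mulfK u'0 (y ^+ _)) -gE' gE.
    by apply: (vringM VP) => //; apply: (vringM VP) => //; apply: (vringX VP).
  have [OPx US frac] := Hl _ VP OPy.
  have [J J0 HJ] := vmax_frob p_prime card_k VQ Ediv Oy g0 Mg.
  (* As e is at least 2, t^e = t^2 t^(e-2) exhibits a double zero of g(y). *)
  apply: (cover_unramified p_prime m_gt0 card_k FF tx VP OPx frac l0 J0 US
     (g := g) _ Mt (w := t ^+ (e - 2) * u)).
  - move=> i; apply: min_g; rewrite rmorphB rmorphXn /= eval_atX; exact: HJ.
  - by apply: (vringM VP) => //; apply: (vringX VP).
  - by rewrite mulrA -exprD subnKC.
exists y; split=> //; split=> [Q1 Q2 /infinite n1 /infinite n2|Q /infinite].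
  exact: infinite_place_unique.
exact: infinite_place_pole.
Qed.
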